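(* Let $M,T,B>0$ and let $f\in\mathbb A^{(2)}_{M,T,B}$ with $f'(0)\ne0$. With $\phi_n=\frac1M\left(\frac TK\right)^n f^{(n)}(0)$ for $n=0,1,2$, let $$g_1=\frac12\,\frac{1-\phi_0^2-2\phi_1}{1-\phi_0^2},\qquad g_2=\frac12\,\frac{(4\phi_1^2-2\phi_2-\phi_0+\phi_0^2+\phi_0^3-2\phi_2\phi_0-1)(1-\phi_0)}{(2\phi_1-\phi_0^2+1)(2\phi_1+\phi_0^2-1)}.$$ Assume that one of the following two conditions holds: (A) $g_1<1/2$ and $g_1^2-4(1-g_1)^2(1-g_2)g_2\ge0$; (B) $g_1>1/2$ and $(1-g_1)^2-4g_1^2g_2(1-g_2)\ge0$. Then there exists $\tau\in(-T,T)$, $\tau\neq0$, such that $f(\tau)=f(0)$.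
   Context: $R_{T,B}\subset\mathbb C$ is the open rectangle $\{z: |\mathrm{Re}\,z|<T,\ |\mathrm{Im}\,z|<B\}$. $\mathbb A_{M,T,B}$ is the set of functions $f$ analytic in $R_{T,B}$, real valued on $(-T,T)$, with $|f(z)|<M$ for all $z\in R_{T,B}$. Let $q=e^{-\pi B/T}$, $\theta_2(0,q)=2\sum_{n\ge0}q^{(n+1/2)^2}$, $\theta_3(0,q)=1+2\sum_{n\ge1}q^{n^2}$, $K=\frac{\pi}{2}\theta_3(0,q)^2$ and $k=\theta_2(0,q)^2/\theta_3(0,q)^2\in(0,1)$; $\mathrm{sn}(\cdot,k)$ is the Jacobi elliptic function of modulus $k$, and $\Phi(z)=\frac{2\,\mathrm{sn}(Kz/T,k)}{1-\mathrm{sn}(Kz/T,k)}$, which maps $R_{T,B}$ into $\mathbb H=\mathbb C\setminus(-\infty,-1]$. Every $f\in\mathbb A_{M,T,B}$ admits a $g$-fraction representation $$f(z)=M\left(1-\frac{2}{\mu_0\sqrt{1+\Phi(z)}\,\{g_1,g_2,\dots\mid\Phi(z)\}+1}\right),\quad z\in R_{T,B},$$ with $\mu_0>0$, $g_i\in[0,1]$, where $$\{g_1,g_2,\dots\mid w\}=\cfrac{1}{1+\cfrac{g_1w}{1+\cfrac{(1-g_1)g_2w}{1+\cfrac{(1-g_2)g_3w}{1+\cdots}}}},\quad w\in\mathbb H .$$ $\mathbb A^{(k)}_{M,T,B}\subset\mathbb A_{M,T,B}$ (here $k=1,2,\dots$ is an index) is the set of functions for which this representation satisfies $g_i\notin\{0,1\}$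 for all $i=1,\dots,k$. For $f\in\mathbb A^{(2)}_{M,T,B}$ the coefficients $g_1,g_2$ of the representation are the ones given by the explicit formulas in the claim. *)

(* Defs.v *)
From Stdlib Require Import Reals.
From Coquelicot Require Import Coquelicot.
Open Scope R_scope.

Definition rect (T B : R) (z : C) : Prop := Rabs (Re z) < T /\ Rabs (Im z) < B.

Definition analytic_at (f : C -> C) (z0 : C) : Prop :=
  exists (a : nat -> C) (r : R), 0 < r /\
    forall z : C, Cmod (z - z0) < r ->
      @is_pseries C_AbsRing C_NormedModule a (z - z0)%C (f z).

Definition class_A (M T B : R) (f : C -> C) : Prop :=
  (forall z, rect T B z -> analytic_at f z) /\
  (forall x : R, - T < x < T -> Im (f (RtoC x)) = 0) /\
  (forall z, rect T B z -> Cmod (f z) < M).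

Definition C_derive_n (f : C -> C) (n : nat) : C -> C := Nat.iter n C_derive f.

(** [sin (x + i y) = sin x cosh y + i cos x sinh y], and similarly for [cos]. *)
Definition Csin (z : C) : C := (sin (Re z) * cosh (Im z), cos (Re z) * sinh (Im z)).
Definition Ccos (z : C) : C := (cos (Re z) * cosh (Im z), - (sin (Re z) * sinh (Im z))).

(** Principal branch: cut along the negative real axis, nonnegative real part. *)
Definition Csqrt (z : C) : C :=
  (sqrt ((Cmod z + Re z) / 2),
   (if Rlt_dec (Im z) 0 then -1 else 1) * sqrt ((Cmod z - Re z) / 2)).

Definition CSeries (a : nat -> C) : C :=
  (Series (fun n => Re (a n)), Series (fun n => Im (a n))).

(** [q] is the nome, in (0,1). *)
Definition theta2_0 (q : R) : R :=
  2 * Series (fun n => Rpower q ((INR n + 1 / 2) ^ 2)).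

Definition theta3_0 (q : R) : R :=
  1 + 2 * Series (fun n => q ^ (S n * S n)).

Definition theta1 (q : R) (z : C) : C :=
  (2 * CSeries (fun n =>
         RtoC ((-1) ^ n * Rpower q ((INR n + 1 / 2) ^ 2)) *
         Csin (RtoC (INR (2 * n + 1)) * z)))%C.

Definition theta4 (q : R) (z : C) : C :=
  (1 + 2 * CSeries (fun n =>
         RtoC ((-1) ^ (S n) * q ^ (S n * S n)) *
         Ccos (RtoC (INR (2 * S n)) * z)))%C.

Definition ellK (q : R) : R := PI / 2 * theta3_0 q ^ 2.
Definition modulus (q : R) : R := theta2_0 q ^ 2 / theta3_0 q ^ 2.

(** [sn (u, k)] for [k = modulus q], by the classical theta quotient
    [sn (u, k) = k^(-1/2) theta1 (zeta, q) / theta4 (zeta, q)],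
    [zeta = PI u / (2 K)]; the nome [q] determines [k] and conversely. *)
Definition jacobi_sn (q : R) (u : C) : C :=
  let zeta := (RtoC (PI / (2 * ellK q)) * u)%C in
  (RtoC (/ sqrt (modulus q)) * (theta1 q zeta / theta4 q zeta))%C.

Definition nome (T B : R) : R := exp (- (PI * B / T)).

Definition Phi (T B : R) (z : C) : C :=
  let s := jacobi_sn (nome T B) (RtoC (ellK (nome T B) / T) * z)%C in
  (2 * s / (1 - s))%C.

(** Coefficients [g] are indexed from 1; [g 0] is unused.
    The n-th partial numerator is [gnum g n * w]. *)
Definition gnum (g : nat -> R) (n : nat) : R :=
  match n with
  | O => 0
  | 1%nat => g 1%nat
  | S m => (1 - g m) * g n
  end.

(** [1 + c_{j+1} w / (1 + c_{j+2} w / (... / (1 + c_{j+n} w)))] *)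
Fixpoint gfrac_tail (g : nat -> R) (w : C) (n j : nat) : C :=
  match n with
  | O => 1%C
  | S m => (1 + RtoC (gnum g (S j)) * w / gfrac_tail g w m (S j))%C
  end.

Definition gfrac_approximant (g : nat -> R) (w : C) (n : nat) : C :=
  (1 / gfrac_tail g w n 0)%C.

(** [{g_1, g_2, ... | w} = v]: the approximants converge to [v]. *)
Definition is_gfrac (g : nat -> R) (w v : C) : Prop :=
  filterlim (gfrac_approximant g w) eventually (locally v).

Definition gfrac_representation (M T B mu0 : R) (g : nat -> R) (f : C -> C) : Prop :=
  0 < mu0 /\
  (forall i : nat, (1 <= i)%nat -> 0 <= g i <= 1) /\
  (forall z : C, rect T B z ->
     exists v : C, is_gfrac g (Phi T B z) v /\
       f z = (RtoC M * (1 - 2 / (RtoC mu0 * Csqrt (1 + Phi T B z) * v + 1)))%C).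

Definition class_A_index (k : nat) (M T B : R) (f : C -> C) : Prop :=
  class_A M T B f /\
  exists (mu0 : R) (g : nat -> R),
    gfrac_representation M T B mu0 g f /\
    (forall i : nat, (1 <= i <= k)%nat -> g i <> 0 /\ g i <> 1).

(** [phi_n = (1/M) (T/K)^n f^(n)(0)]; taking [Re] loses nothing, because [f] is
    real on (-T,T), so that its derivatives at 0 are real. *)
Definition phi_coef (M T B : R) (f : C -> C) (n : nat) : R :=
  1 / M * (T / ellK (nome T B)) ^ n * Re (C_derive_n f n 0%C).

Definition g1_of (p0 p1 : R) : R :=
  1 / 2 * ((1 - p0 ^ 2 - 2 * p1) / (1 - p0 ^ 2)).

Definition g2_of (p0 p1 p2 : R) : R :=
  1 / 2 *
  (((4 * p1 ^ 2 - 2 * p2 - p0 + p0 ^ 2 + p0 ^ 3 - 2 * p2 * p0 - 1) * (1 - p0)) /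
   ((2 * p1 - p0 ^ 2 + 1) * (2 * p1 + p0 ^ 2 - 1))).

(* Main.v *)
Require Import Defs.
From Stdlib Require Import Reals Ranalysis5 Lra Lia.
From Coquelicot Require Import Coquelicot.
Open Scope R_scope.

(** On the real axis the representation of [f] reads
    [f x = M (1 - 2 / (mu h(w) + 1))], [w = Phi x],
    [h(w) = sqrt (1 + w) {g_1, g_2, ... | w}],
    and [Phi 0 = 0], [h(0) = 1].  Hence [f tau = f 0] as soon as [h (Phi tau) = 1], and
    [f' 0] has the sign of [1/2 - g_1].  By the intermediate value theorem it is enough
    to find one [w <> 0] at which [h] has come back to the other side of 1
    ([return_incr], [return_decr]).

    The coefficients after [g_2] are unknown, but for [w > -1] the tail of the continued
    fraction that they form lies between [1] and [1 + (1 - g_2) w] ([rtail_bounds]), so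
    that [{g_1, g_2, ... | w}] lies between the two rational functions obtained from these
    extreme tails ([gfrac_bounds]).  For [g_1 < 1/2], take the extreme tail 1.  After
    squaring, the comparison of [sqrt (1 + w)] times this rational function with 1 is
    decided by the sign of [w Q(w)] for a quadratic [Q] with
    [Q(0) = 1 - 2 g_1 > 0], whose discriminant is [g_1^2] times the quantity assumed
    nonnegative in case (A); its vertex is a point [w <> 0] of [(-1, oo)] as
    required ([quadratic_nonpos_at_vertex]).  For [g_1 > 1/2] the other extreme tail
    leads to the same [Q] with [g_i] replaced by [1 - g_i].  Every [w > -1] is of use
    because [sn] runs from 0 to [1] or [-1] as [x] runs from 0 to [T] or [- T]
    ([rPhi_hits]).

    It remains to see that the [g_1], [g_2] computed from the derivatives of [f] are
    those of the representation ([representation_coefficients]).  The two rational bounds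
    agree to second order at [w = 0], so the second-order Taylor polynomial of [f] at 0
    is an explicit function of [mu], [g_1], [g_2], provided that
    [sn u = u + O(u^3)].  With [sn] a quotient of theta functions, [sn' 0 = 1] is the
    identity of Jacobi [theta_1' = theta_2 theta_3 theta_4] at the origin
    ([jacobi_theta_constants]).  It comes from a finite form of the triple product
    ([finite_triple_product]), which writes four finite products as sums weighted by
    Gaussian binomials; these products satisfy an exact identity for every [N]
    ([euler_finite]), and the theorem of Tannery lets [N] tend to infinity in the sums. *)

(** * Gaussian binomials and a finite triple product *)

(** The binomial coefficient [n (n - 1) / 2], by recursion rather than by a truncated division. *)
Fixpoint choose2 (n : nat) : nat :=
  match n with O => O | S m => (m + choose2 m)%nat end.

Fixpoint gauss_binom (p : R) (m k : nat) : R :=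
  match m, k with
  | _, O => 1
  | O, S _ => 0
  | S m', S k' => p ^ k * gauss_binom p m' k + gauss_binom p m' k'
  end.

(** The product of [x + y p^j] over [j < m].  Keeping [x] makes it homogeneous in [(x, y)],
    so that shifting the exponents of [p] never produces negative ones. *)
Fixpoint qprod (p : R) (m : nat) (x y : R) : R :=
  match m with
  | O => 1
  | S m' => (x + y) * qprod p m' x (p * y)
  end.

(** The product of [y + p^i] for [1 <= i <= n]. *)
Fixpoint rprod (p : R) (n : nat) (y : R) : R :=
  match n with
  | O => 1
  | S n' => rprod p n' y * (y + p ^ n)
  end.

(** The q-Pochhammer symbol [(p; p)_n]. *)
Fixpoint qpoch (p : R) (n : nat) : R :=
  match n with
  | O => 1
  | S n' => qpoch p n' * (1 - p ^ n)
  end.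

Lemma gauss_binom_0_r p m : gauss_binom p m 0 = 1.
Proof. destruct m; reflexivity. Qed.

Lemma gauss_binom_gt p m k : (m < k)%nat -> gauss_binom p m k = 0.
Proof.
  revert k; induction m as [|m IH]; intros [|k] Hk; try lia; simpl; auto.
  rewrite !IH by lia. ring.
Qed.

(** Peeling off the factor [j = 0] replaces [y] by [p y]; comparing the coefficients of
    [y^k] then gives the Pascal rule that defines [gauss_binom]. *)
Theorem q_binomial p m x y :
  qprod p m x y =
  sum_f_R0 (fun k => gauss_binom p m k * p ^ choose2 k * y ^ k * x ^ (m - k)) m.
Proof.
  revert y; induction m as [|m IH]; intros y.
  - simpl; ring.
  - set (c := fun k => gauss_binom p m k * p ^ choose2 k * (p * y) ^ k * x ^ (m - k)).
    set (B := fun k => match k with O => 0 | S j => y * c j end).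
    transitivity (sum_f_R0 (fun k => x * c k) m + sum_f_R0 B (S m)).
    { rewrite (decomp_sum B) by lia. simpl Init.Nat.pred.
      replace (sum_f_R0 (fun i => B (S i)) m) with (y * sum_f_R0 c m)
        by (rewrite scal_sum; apply sum_eq; intros; simpl; ring).
      replace (sum_f_R0 (fun k => x * c k) m) with (x * sum_f_R0 c m)
        by (rewrite scal_sum; apply sum_eq; intros; ring).
      change (B O) with 0. simpl qprod. rewrite IH. fold c. ring. }
    replace (sum_f_R0 (fun k => x * c k) m)
      with (sum_f_R0 (fun k => gauss_binom p m k * p ^ choose2 k * (p * y) ^ k * x ^ (S m - k)) (S m)).
    2:{ rewrite tech5, (gauss_binom_gt p m (S m)) by lia.
        rewrite Rmult_0_l, Rmult_0_l, Rmult_0_l, Rplus_0_r.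
        apply sum_eq; intros k Hk. unfold c.
        replace (S m - k)%nat with (S (m - k)) by lia. simpl; ring. }
    rewrite <- plus_sum. apply sum_eq; intros k Hk.
    destruct k as [|k].
    + simpl. rewrite gauss_binom_0_r. ring.
    + replace (B (S k)) with (y * c k) by reflexivity. unfold c.
      replace (S m - S k)%nat with (m - k)%nat by lia.
      simpl choose2. rewrite pow_add. rewrite !Rpow_mult_distr.
      simpl. ring.
Qed.

Lemma qprod_scal p m c x y : qprod p m (c * x) (c * y) = c ^ m * qprod p m x y.
Proof.
  revert y; induction m as [|m IH]; intros y; simpl; [ring|].
  replace (p * (c * y)) with (c * (p * y)) by ring. rewrite IH. ring.
Qed.

Lemma qprod_add p m n x y :
  qprod p (m + n) x y = qprod p m x y * qprod p n x (p ^ m * y).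
Proof.
  revert y; induction m as [|m IH]; intros y; simpl.
  - rewrite !Rmult_1_l; reflexivity.
  - rewrite IH. replace (p ^ m * (p * y)) with (p * p ^ m * y) by ring. ring.
Qed.

(** Taking [p^j] out of the factor [p^n + y p^j] leaves [p^(n-j) + y]. *)
Lemma qprod_reverse p n y : qprod p n (p ^ n) y = p ^ choose2 n * rprod p n y.
Proof.
  induction n as [|n IH]; [simpl; ring|].
  change (qprod p (S n) (p ^ S n) y)
    with ((p ^ S n + y) * qprod p n (p * p ^ n) (p * y)).
  rewrite qprod_scal, IH. simpl choose2. rewrite pow_add. simpl rprod. simpl pow. ring.
Qed.

(** The value at [k - N], possibly negative, of the polynomial [d (d - 1) / 2]; for [d < 0]
    it equals [choose2 (1 - d)]. *)
Definition choose2_diff (N k : nat) : nat :=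
  if Nat.ltb k N then choose2 (S (N - k)) else choose2 (k - N).

Lemma two_choose2 n : (2 * choose2 n + n = n * n)%nat.
Proof. induction n; simpl in *; nia. Qed.

(** The q-binomial theorem for [N + n] factors with [x = p^N]: the first [N] factors turn
    into [rprod], the others into [qprod], and the extracted powers of [p] complete
    [choose2 k] to [choose2_diff N k]. *)
Theorem finite_triple_product p N n y : p <> 0 ->
  rprod p N y * qprod p n 1 y =
  sum_f_R0 (fun k => gauss_binom p (N + n) k * p ^ choose2_diff N k * y ^ k) (N + n).
Proof.
  intros Hp.
  assert (H := q_binomial p (N + n) (p ^ N) y).
  rewrite qprod_add, qprod_reverse in H.
  replace (qprod p n (p ^ N) (p ^ N * y)) with ((p ^ N) ^ n * qprod p n 1 y) in H
    by (rewrite <- qprod_scal, Rmult_1_r; reflexivity).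
  apply (Rmult_eq_reg_l (p ^ choose2 N * (p ^ N) ^ n)).
  2:{ apply Rmult_integral_contrapositive_currified; repeat apply pow_nonzero; auto. }
  transitivity (p ^ choose2 N * rprod p N y * ((p ^ N) ^ n * qprod p n 1 y)); [ring|].
  rewrite H, scal_sum. apply sum_eq; intros k Hk.
  rewrite <- !pow_mult.
  transitivity (gauss_binom p (N + n) k * y ^ k * (p ^ (choose2 k + N * (N + n - k)))).
  { rewrite pow_add; ring. }
  replace (choose2 k + N * (N + n - k))%nat with (choose2_diff N k + (choose2 N + N * n))%nat.
  { rewrite !pow_add; ring. }
  unfold choose2_diff.
  pose proof (two_choose2 k); pose proof (two_choose2 N).
  destruct (Nat.ltb_spec k N).
  - pose proof (two_choose2 (S (N - k))) as H3.
    assert (exists d, N = k + d)%nat as [d ->] by (exists (N - k)%nat; lia).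
    replace (k + d - k)%nat with d in * by lia.
    replace (k + d + n - k)%nat with (d + n)%nat by lia. nia.
  - pose proof (two_choose2 (k - N)) as H3.
    assert (exists d, k = N + d)%nat as [d ->] by (exists (k - N)%nat; lia).
    replace (N + d - N)%nat with d in * by lia.
    assert (exists e, n = d + e)%nat as [e ->] by (exists (n - d)%nat; lia).
    replace (N + (d + e) - (N + d))%nat with e by lia. nia.
Qed.

Lemma gauss_binom_qpoch p m k : (k <= m)%nat ->
  gauss_binom p m k * (qpoch p k * qpoch p (m - k)) = qpoch p m.
Proof.
  revert k; induction m as [|m IH]; intros [|k] Hk; try lia.
  - simpl; ring.
  - simpl gauss_binom. rewrite Nat.sub_0_r. simpl; ring.
  - replace (S m - S k)%nat with (m - k)%nat by lia.
    assert (H1 := IH k ltac:(lia)).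
    change (gauss_binom p (S m) (S k)) with (p ^ S k * gauss_binom p m (S k) + gauss_binom p m k).
    destruct (Nat.eq_dec k m) as [->|Hkm].
    + rewrite gauss_binom_gt by lia. replace (m - m)%nat with 0%nat in * by lia.
      simpl in *. rewrite <- H1 at 2. ring.
    + assert (H2 := IH (S k) ltac:(lia)).
      replace (m - k)%nat with (S (m - S k)) in * by lia.
      set (j := (m - S k)%nat) in *.
      assert (E : p ^ S m = p ^ S k * p ^ S j) by (rewrite <- pow_add; f_equal; lia).
      change (qpoch p (S m)) with (qpoch p m * (1 - p ^ S m)). rewrite E.
      change (qpoch p (S k)) with (qpoch p k * (1 - p ^ S k)) in *.
      change (qpoch p (S j)) with (qpoch p j * (1 - p ^ S j)) in *.
      transitivity (p ^ S k * (1 - p ^ S j) * (gauss_binom p m (S k) * (qpoch p k * (1 - p ^ S k) * qpoch p j))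
        + (1 - p ^ S k) * (gauss_binom p m k * (qpoch p k * (qpoch p j * (1 - p ^ S j))))); [ring|].
      rewrite H1, H2. ring.
Qed.

(** * Finite forms of the theta constants *)

Lemma sum_f_R0_reverse t N :
  sum_f_R0 t N = sum_f_R0 (fun i => t (N - i)%nat) N.
Proof.
  induction N as [|N IH]; [reflexivity|].
  rewrite tech5, IH, (decomp_sum (fun i => t (S N - i)%nat)) by lia.
  simpl Init.Nat.pred. rewrite Nat.sub_0_r.
  rewrite Rplus_comm. reflexivity.
Qed.

Lemma sum_f_R0_pair t N :
  sum_f_R0 t (2 * N + 1) =
  sum_f_R0 (fun i => t (N + 1 + i)%nat + t (N - i)%nat) N.
Proof.
  rewrite (tech2 t N) by lia.
  replace (2 * N + 1 - S N)%nat with N by lia.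
  rewrite plus_sum, (sum_f_R0_reverse t N), Rplus_comm. f_equal.
  apply sum_eq; intros; f_equal; lia.
Qed.

Lemma choose2_diff_right N i : choose2_diff N (N + i) = choose2 i.
Proof.
  unfold choose2_diff. destruct (Nat.ltb_spec (N + i) N); [lia|].
  f_equal; lia.
Qed.

Lemma choose2_diff_left N i : (i <= N)%nat -> choose2_diff N (N - i) = choose2 (S i).
Proof.
  intros Hi. unfold choose2_diff. destruct (Nat.ltb_spec (N - i) N).
  - f_equal; lia.
  - replace i with O by lia. rewrite Nat.sub_0_r, Nat.sub_diag. reflexivity.
Qed.

Lemma qprod_S_r p n x y : qprod p (S n) x y = qprod p n x y * (x + p ^ n * y).
Proof. rewrite <- Nat.add_1_r, qprod_add. simpl. ring. Qed.

(** For [p = q^2] and [y = z q] the exponents become the squares [(k - N)^2]; with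
    [z = 1] and [z = -1] these are the truncations of [theta_3] and [theta_4] at 0.
    The terms [k = N + 1 + i] and [k = N - i] are paired. *)
Lemma theta_even_finite q z N : 0 < q -> z * z = 1 ->
  (qprod (q ^ 2) N 1 (z * q)) ^ 2 =
  sum_f_R0 (fun i => gauss_binom (q ^ 2) (2 * N) (N + 1 + i) * (z ^ S i * q ^ (S i * S i))
                     + gauss_binom (q ^ 2) (2 * N) (N - i) * (z ^ i * q ^ (i * i))) N.
Proof.
  intros Hq Hz.
  assert (Hq2 : q ^ 2 <> 0) by (apply pow_nonzero; lra).
  assert (Hz0 : z <> 0) by nra.
  (* [z q + q^(2i) = z q (1 + z q^(2i-1))], because [1 / z = z]. *)
  assert (Hrev : forall n, rprod (q ^ 2) n (z * q) = (z * q) ^ n * qprod (q ^ 2) n 1 (z * q)).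
  { induction n as [|n IH]; [simpl; ring|].
    rewrite qprod_S_r.
    change (rprod (q ^ 2) (S n) (z * q))
      with (rprod (q ^ 2) n (z * q) * (z * q + q ^ 2 * (q ^ 2) ^ n)).
    rewrite IH. generalize ((q ^ 2) ^ n) as P; intros P. simpl.
    replace (q * (q * 1) * P) with ((z * z) * (q * q * P)) by (rewrite Hz; ring).
    ring. }
  assert (Hzq : z * q <> 0) by (apply Rmult_integral_contrapositive_currified; lra).
  apply (Rmult_eq_reg_l ((z * q) ^ N)); [|apply pow_nonzero; assumption].
  transitivity (rprod (q ^ 2) N (z * q) * qprod (q ^ 2) N 1 (z * q)).
  { rewrite Hrev. ring. }
  rewrite finite_triple_product by assumption.
  replace (N + N)%nat with (2 * N)%nat by lia.
  set (t := fun k => gauss_binom (q ^ 2) (2 * N) k * (q ^ 2) ^ choose2_diff N k * (z * q) ^ k).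
  (* The added term vanishes; it makes the number of terms even, ready for pairing. *)
  transitivity (sum_f_R0 t (2 * N + 1)).
  { rewrite Nat.add_1_r, tech5. unfold t at 3. rewrite gauss_binom_gt by lia. ring. }
  rewrite sum_f_R0_pair, scal_sum. apply sum_eq; intros i Hi. unfold t.
  replace (N + 1 + i)%nat with (N + S i)%nat by lia.
  rewrite choose2_diff_right, choose2_diff_left by assumption.
  rewrite Rmult_plus_distr_r. f_equal.
  - rewrite <- pow_mult, !Rpow_mult_distr, !pow_add.
    pose proof (two_choose2 (S i)) as H2.
    rewrite <- H2. rewrite pow_add. ring.
  - rewrite <- pow_mult.
    assert (E : (z * q) ^ N = (z * q) ^ (N - i) * (z * q) ^ i)
      by (rewrite <- pow_add; f_equal; lia).
    rewrite E.
    assert (E2 : (z * q) ^ i * (z ^ i * q ^ (i * i)) = q ^ (2 * choose2 (S i))).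
    { rewrite Rpow_mult_distr.
      transitivity ((z * z) ^ i * (q ^ i * q ^ (i * i))).
      - rewrite Rpow_mult_distr. ring.
      - rewrite Hz, pow1, <- pow_add, Rmult_1_l. f_equal.
        pose proof (two_choose2 (S i)); lia. }
    rewrite <- E2. ring.
Qed.

Lemma qpoch_pos p n : 0 < p < 1 -> 0 < qpoch p n.
Proof.
  intros Hp. induction n as [|n IH]; [simpl; lra|].
  assert (p ^ S n < 1) by (apply pow_lt_1_compat; [lra|lia]).
  simpl in *. nra.
Qed.

Lemma gauss_binom_sym p m k : 0 < p < 1 -> (k <= m)%nat -> gauss_binom p m (m - k) = gauss_binom p m k.
Proof.
  intros Hp Hk.
  pose proof (gauss_binom_qpoch p m k Hk) as H1.
  pose proof (gauss_binom_qpoch p m (m - k) ltac:(lia)) as H2.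
  replace (m - (m - k))%nat with k in H2 by lia.
  pose proof (qpoch_pos p k Hp). pose proof (qpoch_pos p (m - k) Hp).
  apply (Rmult_eq_reg_r (qpoch p k * qpoch p (m - k))); [|nra].
  rewrite H1, <- H2. ring.
Qed.

(** With one factor more on the right than on the left the exponents are symmetric about a
    half-integer, and the terms [k = N + 1 + i] and [k = N - i] have equal weights. *)
Lemma theta_odd_finite p y N : 0 < p < 1 ->
  (1 + y) * (rprod p N y * qprod p N 1 (p * y)) =
  sum_f_R0 (fun i => gauss_binom p (2 * N + 1) (N - i) * p ^ choose2 (S i)
                     * (y ^ (N - i) * (1 + y ^ (2 * i + 1)))) N.
Proof.
  intros Hp.
  transitivity (rprod p N y * qprod p (S N) 1 y); [simpl; ring|].
  rewrite finite_triple_product by lra.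
  replace (N + S N)%nat with (2 * N + 1)%nat by lia.
  rewrite sum_f_R0_pair. apply sum_eq; intros i Hi.
  replace (N + 1 + i)%nat with (N + S i)%nat by lia.
  rewrite choose2_diff_right, choose2_diff_left by assumption.
  replace (gauss_binom p (2 * N + 1) (N + S i)) with (gauss_binom p (2 * N + 1) (N - i)).
  2:{ rewrite <- gauss_binom_sym by (assumption || lia). f_equal; lia. }
  replace (N + S i)%nat with (N - i + (2 * i + 1))%nat by lia.
  rewrite (pow_add y). ring.
Qed.

Lemma rprod_1 p n : rprod p n 1 = qprod p n 1 p.
Proof.
  induction n as [|n IH]; [reflexivity|].
  rewrite qprod_S_r, <- IH. simpl. ring.
Qed.

(** The case [y = 1]: a truncation of [theta_2] at 0. *)
Lemma theta2_finite p N : 0 < p < 1 ->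
  (qprod p N 1 p) ^ 2 =
  sum_f_R0 (fun i => gauss_binom p (2 * N + 1) (N - i) * p ^ choose2 (S i)) N.
Proof.
  intros Hp. pose proof (theta_odd_finite p 1 N Hp) as H.
  rewrite rprod_1, Rmult_1_r in H.
  apply (Rmult_eq_reg_l 2); [|lra].
  rewrite scal_sum. transitivity ((1 + 1) * (qprod p N 1 p * qprod p N 1 p)); [ring|].
  rewrite H. apply sum_eq; intros i Hi. rewrite !pow1. ring.
Qed.

Lemma continuity_sum_f_R0 (f : nat -> R -> R) N :
  (forall i, continuity (f i)) -> continuity (fun y => sum_f_R0 (fun i => f i y) N).
Proof.
  intros Hf. induction N as [|N IH]; simpl; [apply Hf|].
  apply (continuity_plus _ (f (S N)) IH (Hf _)).
Qed.

Lemma continuity_pow n : continuity (fun y => y ^ n).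
Proof. apply derivable_continuous, derivable_pow. Qed.

Lemma continuity_rprod p n : continuity (fun y => rprod p n y).
Proof.
  induction n as [|n IH]; simpl.
  - apply continuity_const. intros x y; reflexivity.
  - apply (continuity_mult _ (fun y => y + p * p ^ n) IH).
    apply (continuity_plus (fun y => y) (fun _ => p * p ^ n)).
    + apply derivable_continuous, derivable_id.
    + apply continuity_const. intros x y; reflexivity.
Qed.

Lemma continuity_qprod p n c : continuity (fun y => qprod p n 1 (c * y)).
Proof.
  revert c; induction n as [|n IH]; intros c; simpl.
  - apply continuity_const. intros x y; reflexivity.
  - apply (continuity_mult (fun y => 1 + c * y) (fun y => qprod p n 1 (p * (c * y)))).
    + apply (continuity_plus (fun _ => 1) (fun y => c * y)).
      * apply continuity_const. intros x y; reflexivity.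
      * apply (continuity_scal (fun y => y)). apply derivable_continuous, derivable_id.
    + intros x. apply (continuity_pt_ext (fun y => qprod p n 1 (p * c * y))).
      * intros y. f_equal. ring.
      * apply IH.
Qed.

Lemma continuous_eq_off_point (f g : R -> R) a :
  continuity f -> continuity g -> (forall x, x <> a -> f x = g x) -> f a = g a.
Proof.
  intros Hf Hg H.
  assert (Hc : is_lim (fun x => f x - g x) a (f a - g a)).
  { apply (is_lim_continuity (fun x => f x - g x)).
    apply (continuity_minus f g Hf Hg a). }
  assert (H0 : is_lim (fun x => f x - g x) a 0).
  { apply (is_lim_ext_loc (fun _ => 0)).
    - exists (mkposreal 1 Rlt_0_1). intros x _ Hx. rewrite H by exact Hx. ring.
    - apply is_lim_const. }
  apply is_lim_unique in Hc. apply is_lim_unique in H0.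
  rewrite Hc in H0. injection H0. lra.
Qed.

(** Both sides of [theta_odd_finite] vanish at [y = -1]; dividing by [1 + y] and letting [y]
    tend to [-1] turns [1 + y^(2i+1)] into [2i+1].  This is a truncation of the
    derivative of [theta_1] at 0. *)
Lemma jacobi_cube_finite p N : 0 < p < 1 ->
  (qpoch p N) ^ 2 =
  sum_f_R0 (fun i => gauss_binom p (2 * N + 1) (N - i)
                     * ((-1) ^ i * (2 * INR i + 1) * p ^ choose2 (S i))) N.
Proof.
  intros Hp.
  set (alt := fun i y => sum_f_R0 (fun j => (-1) ^ j * y ^ j) (2 * i)).
  assert (Halt : forall i y, (1 + y) * alt i y = 1 + y ^ (2 * i + 1)).
  { intros i y. unfold alt. induction i as [|i IH]; [simpl; ring|].
    replace (2 * S i)%nat with (S (S (2 * i))) by lia.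
    rewrite !tech5, !Rmult_plus_distr_l, IH.
    replace (S (S (2 * i)) + 1)%nat with (2 * i + 3)%nat by lia.
    rewrite !pow_add, <- !tech_pow_Rmult, pow_1_even.
    generalize (y ^ (2 * i)) as P; intros P. ring. }
  set (c := fun i => gauss_binom p (2 * N + 1) (N - i) * p ^ choose2 (S i)).
  assert (E : rprod p N (-1) * qprod p N 1 (p * -1) =
              sum_f_R0 (fun i => c i * ((-1) ^ (N - i) * alt i (-1))) N).
  { apply (continuous_eq_off_point
             (fun y => rprod p N y * qprod p N 1 (p * y))
             (fun y => sum_f_R0 (fun i => c i * (y ^ (N - i) * alt i y)) N)).
    - apply (continuity_mult (fun y => rprod p N y) (fun y => qprod p N 1 (p * y))).
      + apply continuity_rprod.
      + apply continuity_qprod.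
    - apply (continuity_sum_f_R0 (fun i y => c i * (y ^ (N - i) * alt i y))).
      intros i. apply (continuity_scal (fun y => y ^ (N - i) * alt i y)).
      apply (continuity_mult (fun y => y ^ (N - i)) (alt i)).
      + apply continuity_pow.
      + apply (continuity_sum_f_R0 (fun j y => (-1) ^ j * y ^ j)).
        intros j. apply (continuity_scal (fun y => y ^ j)), continuity_pow.
    - intros y Hy. apply (Rmult_eq_reg_l (1 + y)); [|lra].
      rewrite theta_odd_finite by assumption. rewrite scal_sum.
      apply sum_eq; intros i Hi. rewrite <- Halt. unfold c. ring. }
  assert (Hr : forall n, rprod p n (-1) = (-1) ^ n * qpoch p n).
  { induction n as [|n IH]; simpl; [ring|]. rewrite IH. ring. }
  assert (Hq : forall n, qprod p n 1 (p * -1) = qpoch p n).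
  { induction n as [|n IH]; [reflexivity|]. rewrite qprod_S_r, IH. simpl. ring. }
  assert (Ha : forall i, alt i (-1) = 2 * INR i + 1).
  { intros i. unfold alt.
    rewrite (sum_eq _ (fun _ => 1)).
    - rewrite sum_cte, S_INR, mult_INR. simpl. ring.
    - intros j _. rewrite <- Rpow_mult_distr. replace (-1 * -1) with 1 by ring.
      apply pow1. }
  assert (Hs : forall n, (-1) ^ n * (-1) ^ n = 1).
  { intros n. rewrite <- Rpow_mult_distr. replace (-1 * -1) with 1 by ring. apply pow1. }
  rewrite Hr, Hq in E.
  transitivity ((-1) ^ N * ((-1) ^ N * qpoch p N * qpoch p N)).
  { rewrite <- !Rmult_assoc, Hs. ring. }
  rewrite E, scal_sum. apply sum_eq; intros i Hi. rewrite Ha. unfold c.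
  assert (E2 : (-1) ^ N = (-1) ^ (N - i) * (-1) ^ i) by (rewrite <- pow_add; f_equal; lia).
  rewrite E2.
  transitivity (gauss_binom p (2 * N + 1) (N - i) * p ^ choose2 (S i) * (2 * INR i + 1) * (-1) ^ i
    * ((-1) ^ (N - i) * (-1) ^ (N - i))); [ring|].
  rewrite Hs. ring.
Qed.

(** Odd factors [1 - p^(2j-1)] come from the first two products and even ones
    [1 - p^(2j)] from the last two. *)
Lemma euler_finite q N :
  qprod (q ^ 2) N 1 (1 * q) * qprod (q ^ 2) N 1 (-1 * q) * qprod (q ^ 2) N 1 (q ^ 2)
  * qpoch (q ^ 2) N = qpoch (q ^ 2) (2 * N).
Proof.
  induction N as [|N IH]; [simpl; ring|].
  rewrite !qprod_S_r. replace (2 * S N)%nat with (S (S (2 * N))) by lia.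
  change (qpoch (q ^ 2) (S N)) with (qpoch (q ^ 2) N * (1 - (q ^ 2) ^ S N)).
  change (qpoch (q ^ 2) (S (S (2 * N))))
    with (qpoch (q ^ 2) (2 * N) * (1 - (q ^ 2) ^ S (2 * N)) * (1 - (q ^ 2) ^ S (S (2 * N)))).
  rewrite <- IH.
  replace ((q ^ 2) ^ S (2 * N)) with (q ^ 2 * ((q ^ 2) ^ N * (q ^ 2) ^ N))
    by (replace (S (2 * N)) with (1 + (N + N))%nat by lia; rewrite !(pow_add (q ^ 2)); ring).
  replace ((q ^ 2) ^ S (S (2 * N))) with (q ^ 2 * (q ^ 2) * ((q ^ 2) ^ N * (q ^ 2) ^ N))
    by (replace (S (S (2 * N))) with (2 + (N + N))%nat by lia; rewrite !(pow_add (q ^ 2)); ring).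
  replace ((q ^ 2) ^ S N) with (q ^ 2 * (q ^ 2) ^ N) by reflexivity.
  generalize ((q ^ 2) ^ N) as P; intros P. ring.
Qed.

(** * Passage to the limit *)

Lemma sum_f_R0_Rle_abs (u b : nat -> R) N :
  (forall i, (i <= N)%nat -> Rabs (u i) <= b i) -> Rabs (sum_f_R0 u N) <= sum_f_R0 b N.
Proof.
  intros H. eapply Rle_trans; [apply Rsum_abs|]. apply sum_Rle; auto.
Qed.

Lemma Un_cv_Series (a : nat -> R) : ex_series a -> Un_cv (sum_f_R0 a) (Series a).
Proof.
  intros H. apply is_lim_seq_Reals.
  apply (is_lim_seq_ext (sum_n a)); [intros; apply sum_n_Reals|].
  exact (Series_correct a H).
Qed.

Lemma Un_cv_sum_f_R0 (u : nat -> nat -> R) (l : nat -> R) n :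
  (forall i, is_lim_seq (fun N => u N i) (l i)) ->
  Un_cv (fun N => sum_f_R0 (u N) n) (sum_f_R0 l n).
Proof.
  intros H. induction n as [|n IH]; simpl.
  - apply is_lim_seq_Reals, H.
  - apply CV_plus; [exact IH|]. apply is_lim_seq_Reals, H.
Qed.

(** Dominated convergence for series, in the form where the number of terms grows with the
    parameter. *)
Lemma tannery (u : nat -> nat -> R) (l b : nat -> R) :
  (forall N i, (i <= N)%nat -> Rabs (u N i) <= b i) -> ex_series b ->
  (forall i, is_lim_seq (fun N => u N i) (l i)) ->
  is_lim_seq (fun N => sum_f_R0 (u N) N) (Series l).
Proof.
  intros Hb Eb Hl.
  assert (Hlb : forall i, Rabs (l i) <= b i).
  { intros i.
    apply (is_lim_seq_le_loc (fun N => Rabs (u N i)) (fun _ => b i) (Rabs (l i)) (b i)).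
    - exists i. intros N HN. apply Hb; exact HN.
    - apply (is_lim_seq_abs _ (l i)), Hl.
    - apply is_lim_seq_const. }
  assert (El : ex_series l) by (apply (ex_series_le l b); assumption).
  pose proof (Un_cv_Series b Eb) as Cb. pose proof (Un_cv_Series l El) as Cl.
  apply is_lim_seq_Reals. intros eps He.
  destruct (Cb (eps / 8)) as [n1 H1]; [lra|].
  destruct (Cl (eps / 4)) as [n2 H2]; [lra|].
  set (n := Nat.max n1 n2).
  destruct (Un_cv_sum_f_R0 u l n Hl (eps / 4)) as [n3 H3]; [lra|].
  exists (Nat.max (S n) n3). intros N HN.
  assert (HnN : (n < N)%nat) by lia.
  specialize (H3 N ltac:(lia)). specialize (H2 n ltac:(lia)).
  pose proof (H1 n ltac:(lia)) as H1n. pose proof (H1 N ltac:(lia)) as H1N.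
  unfold Rdist in *.
  assert (Ht : Rabs (sum_f_R0 (u N) N - sum_f_R0 (u N) n)
               <= sum_f_R0 b N - sum_f_R0 b n).
  { rewrite (tech2 (u N) n N), (tech2 b n N) by exact HnN.
    match goal with |- Rabs (?a + ?c - _) <= _ => replace (a + c - a) with c by ring end.
    match goal with |- _ <= ?a + ?c - _ => replace (a + c - a) with c by ring end.
    apply sum_f_R0_Rle_abs. intros i Hi. apply Hb. lia. }
  apply Rabs_def2 in H1n, H1N, H2, H3. apply Rabs_le_between in Ht.
  apply Rabs_def1; lra.
Qed.

Lemma qpoch_le_1 p n : 0 < p < 1 -> qpoch p n <= 1.
Proof.
  intros Hp. induction n as [|n IH]; [simpl; lra|].
  pose proof (pow_lt p (S n) (proj1 Hp)). pose proof (qpoch_pos p n Hp).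
  simpl in *. nra.
Qed.

(** The limit is positive because, once [t = p^(J+1) / (1 - p) <= 1/2], the remaining factors
    lose at most the total [t] of the geometric series that they subtract. *)
Lemma qpoch_limit p : 0 < p < 1 ->
  exists L, 0 < L /\ is_lim_seq (qpoch p) L /\ forall n, L <= qpoch p n.
Proof.
  intros Hp.
  assert (Hdec : forall n, qpoch p (S n) <= qpoch p n).
  { intros n. pose proof (pow_lt p (S n) (proj1 Hp)). pose proof (qpoch_pos p n Hp).
    simpl in *. nra. }
  destruct (ex_finite_lim_seq_decr (qpoch p) 0 Hdec) as [L HL].
  { intros n. apply Rlt_le, qpoch_pos, Hp. }
  exists L. split; [|split; [exact HL|apply is_lim_seq_decr_compare; assumption]].
  assert (HJ : exists J, p ^ S J <= (1 - p) / 2).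
  { destruct (pow_lt_1_zero p) with (y := (1 - p) / 2) as [J HJ].
    - rewrite Rabs_pos_eq; lra.
    - lra.
    - exists J. specialize (HJ (S J) ltac:(lia)).
      apply Rabs_def2 in HJ. lra. }
  (* The sum of the geometric series [p^(J+1) + p^(J+2) + ...]. *)
  destruct HJ as [J HJ]. set (t := p ^ S J / (1 - p)).
  assert (Et : p ^ S J = t * (1 - p)) by (unfold t; field; lra).
  assert (Ht0 : 0 < t).
  { apply Rdiv_lt_0_compat; [apply pow_lt|]; lra. }
  assert (Ht : t <= 1 / 2) by nra.
  clearbody t.
  assert (Hn : forall n, qpoch p J * (1 - t * (1 - p ^ n)) <= qpoch p (J + n)).
  { induction n as [|n IH].
    - rewrite Nat.add_0_r. simpl. lra.
    - rewrite Nat.add_succ_r.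
      change (qpoch p (S (J + n))) with (qpoch p (J + n) * (1 - p ^ (S J + n))).
      rewrite pow_add, Et.
      change (p ^ S n) with (p * p ^ n).
      pose proof (qpoch_pos p J Hp) as HqJ.
      pose proof (pow_lt p n (proj1 Hp)) as Hpn.
      assert (Hpn1 : p ^ n <= 1).
      { rewrite <- (pow1 n). apply pow_incr. lra. }
      assert (Hx : 0 <= t * (1 - p) * p ^ n <= 1).
      { assert (0 <= t * (1 - p) <= 1) by nra. generalize dependent (p ^ n). intros; nra. }
      apply Rle_trans with
        (qpoch p J * (1 - t * (1 - p ^ n)) * (1 - t * (1 - p) * p ^ n)).
      + assert (0 <= t * (1 - p ^ n)) by nra.
        rewrite Rmult_assoc. apply Rmult_le_compat_l; [lra|]. nra.
      + apply Rmult_le_compat_r; lra. }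
  apply Rlt_le_trans with (qpoch p J / 2).
  { pose proof (qpoch_pos p J Hp). lra. }
  apply (is_lim_seq_le (fun _ => qpoch p J / 2) (fun n => qpoch p (J + n))
           (qpoch p J / 2) L).
  - intros n. eapply Rle_trans; [|apply Hn].
    pose proof (qpoch_pos p J Hp) as H1. pose proof (pow_lt p n (proj1 Hp)) as H2.
    assert (1 / 2 <= 1 - t * (1 - p ^ n)) by nra. nra.
  - apply is_lim_seq_const.
  - apply (is_lim_seq_ext (fun n => qpoch p (n + J))).
    + intros; f_equal; lia.
    + apply (is_lim_seq_incr_n (qpoch p)), HL.
Qed.

Lemma gauss_binom_bound p L m k : 0 < p < 1 -> 0 < L -> (forall n, L <= qpoch p n) ->
  Rabs (gauss_binom p m k) <= / (L * L).
Proof.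
  intros Hp HL0 HLle.
  assert (0 < / (L * L)) by (apply Rinv_0_lt_compat; nra).
  destruct (Nat.le_gt_cases k m) as [Hk|Hk].
  2:{ rewrite gauss_binom_gt, Rabs_R0 by exact Hk. lra. }
  pose proof (gauss_binom_qpoch p m k Hk) as E.
  pose proof (HLle k). pose proof (HLle (m - k)%nat).
  pose proof (qpoch_pos p m Hp). pose proof (qpoch_le_1 p m Hp).
  assert (L * L <= qpoch p k * qpoch p (m - k)) by nra.
  assert (Hg : 0 <= gauss_binom p m k) by nra.
  rewrite Rabs_pos_eq by exact Hg.
  apply (Rmult_le_reg_r (L * L)); [nra|]. rewrite Rinv_l by nra. nra.
Qed.

Lemma gauss_binom_limit p L (phi psi : nat -> nat) : 0 < p < 1 -> 0 < L -> is_lim_seq (qpoch p) L ->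
  filterlim phi eventually eventually -> filterlim psi eventually eventually ->
  is_lim_seq (fun N => gauss_binom p (phi N + psi N) (phi N)) (/ L).
Proof.
  intros Hp HL0 HL Hphi Hpsi.
  apply (is_lim_seq_ext
    (fun N => qpoch p (phi N + psi N) / (qpoch p (phi N) * qpoch p (psi N)))).
  { intros N. rewrite <- (gauss_binom_qpoch p (phi N + psi N) (phi N)) by lia.
    replace (phi N + psi N - phi N)%nat with (psi N) by lia.
    pose proof (qpoch_pos p (phi N) Hp). pose proof (qpoch_pos p (psi N) Hp).
    field. lra. }
  replace (Finite (/ L)) with (Rbar_div L (L * L)) by (simpl; f_equal; field; lra).
  apply is_lim_seq_div'.
  - apply (is_lim_seq_subseq (qpoch p) L (fun N => (phi N + psi N)%nat)); [|exact HL].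
    intros P HP. destruct HP as [n0 H0]. destruct (Hphi (fun n => (n0 <= n)%nat)) as [N0 HN].
    + exists n0; auto.
    + exists N0. intros N HN0. apply H0. specialize (HN N HN0). simpl in HN. lia.
  - apply is_lim_seq_mult'; apply is_lim_seq_subseq; assumption.
  - nra.
Qed.

(** Gaussian binomials are bounded by [1 / L^2] and tend to [1 / L] when both lower
    arguments grow. *)
Lemma gauss_sum_limit p L (m : nat -> nat) (k : nat -> nat -> nat) (c : nat -> R) :
  0 < p < 1 -> 0 < L -> is_lim_seq (qpoch p) L -> (forall n, L <= qpoch p n) ->
  (forall i, filterlim (fun N => k N i) eventually eventually) ->
  (forall i, filterlim (fun N => (m N - k N i)%nat) eventually eventually) ->
  ex_series (fun i => Rabs (c i)) ->
  is_lim_seq (fun N => sum_f_R0 (fun i => gauss_binom p (m N) (k N i) * c i) N) (/ L * Series c).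
Proof.
  intros Hp HL0 HL HLle H1 H2 Hc. rewrite <- Series_scal_l.
  apply (tannery _ _ (fun i => / (L * L) * Rabs (c i))).
  - intros N i _. rewrite Rabs_mult. apply Rmult_le_compat_r; [apply Rabs_pos|].
    apply gauss_binom_bound; assumption.
  - apply (ex_series_scal_l (/ (L * L)) (fun i => Rabs (c i))), Hc.
  - intros i. apply (is_lim_seq_scal_r _ (c i) (/ L)).
    apply (is_lim_seq_ext_loc
      (fun N => gauss_binom p (k N i + (m N - k N i)) (k N i))).
    + destruct (H2 i (fun n => (1 <= n)%nat)) as [N0 HN]; [exists 1%nat; auto|].
      exists N0. intros N HN0. specialize (HN N HN0). simpl in HN. f_equal. lia.
    + apply gauss_binom_limit; auto.
Qed.

(** * Theta constants and the derivative identity of Jacobi *)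

Lemma ex_series_cube_geom q : 0 < q < 1 -> ex_series (fun n => (2 * INR n + 1) ^ 3 * q ^ n).
Proof.
  intros Hq.
  assert (Hpos : forall n, 0 < (2 * INR n + 1) ^ 3 * q ^ n).
  { intros n. pose proof (pos_INR n).
    apply Rmult_lt_0_compat; apply pow_lt; lra. }
  apply (ex_series_ext (fun n => Rabs ((2 * INR n + 1) ^ 3 * q ^ n))).
  { intros n. apply Rabs_pos_eq, Rlt_le, Hpos. }
  apply (ex_series_DAlembert _ q); [lra| |].
  - intros n. apply Rgt_not_eq, Hpos.
  - apply (is_lim_seq_ext (fun n => (1 + 2 * / (2 * INR n + 1)) ^ 3 * q)).
    { intros n. pose proof (pos_INR n) as Hn.
      rewrite Rabs_pos_eq.
      - rewrite S_INR. simpl. field. split; [apply pow_nonzero; lra|lra].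
      - apply Rlt_le, Rdiv_lt_0_compat; apply Hpos. }
    assert (H0 : is_lim_seq (fun n => / (2 * INR n + 1)) 0).
    { apply (is_lim_seq_le_le (fun _ => 0) _ (fun n => / (INR n + 1))).
      - intros n. pose proof (pos_INR n). split.
        + apply Rlt_le, Rinv_0_lt_compat; lra.
        + apply Rinv_le_contravar; lra.
      - apply is_lim_seq_const.
      - replace (Finite 0) with (Rbar_inv p_infty) by reflexivity.
        apply is_lim_seq_inv; [|discriminate].
        apply (is_lim_seq_ext (fun n => INR (n + 1))).
        + intros n. rewrite plus_INR. reflexivity.
        + apply (is_lim_seq_incr_n INR 1), is_lim_seq_INR. }
    assert (H1 : is_lim_seq (fun n => 1 + 2 * / (2 * INR n + 1)) (1 + 2 * 0)).
    { apply is_lim_seq_plus'; [apply is_lim_seq_const|].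
      apply (is_lim_seq_scal_l _ 2 0), H0. }
    replace (Finite q) with (Finite ((1 + 2 * 0) * ((1 + 2 * 0) * ((1 + 2 * 0) * 1)) * q))
      by (f_equal; ring).
    apply (is_lim_seq_mult' _ (fun _ => q)); [|apply is_lim_seq_const].
    simpl. repeat apply is_lim_seq_mult'; try exact H1. apply is_lim_seq_const.
Qed.

Lemma pow_le_pow q m n : 0 < q < 1 -> (n <= m)%nat -> q ^ m <= q ^ n.
Proof.
  intros Hq H. replace m with (n + (m - n))%nat by lia. rewrite pow_add.
  pose proof (pow_lt q n (proj1 Hq)).
  assert (q ^ (m - n) <= 1) by (rewrite <- (pow1 (m - n)); apply pow_incr; lra).
  nra.
Qed.

Lemma ex_series_poly_pow q (c : nat -> R) (e : nat -> nat) K : 0 < q < 1 ->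
  (forall n, Rabs (c n) <= K * (2 * INR n + 1) ^ 3) -> (forall n, (n <= e n)%nat) ->
  ex_series (fun n => Rabs (c n * q ^ e n)).
Proof.
  intros Hq Hc He.
  apply (ex_series_le (fun n => Rabs (c n * q ^ e n))
           (fun n => K * ((2 * INR n + 1) ^ 3 * q ^ n))).
  - intros n. change (Rabs (Rabs (c n * q ^ e n)) <= K * ((2 * INR n + 1) ^ 3 * q ^ n)).
    rewrite Rabs_Rabsolu, Rabs_mult, <- Rmult_assoc.
    pose proof (pow_lt q (e n) (proj1 Hq)).
    rewrite (Rabs_pos_eq (q ^ e n)) by lra.
    apply Rmult_le_compat; [apply Rabs_pos|lra|apply Hc|].
    apply pow_le_pow; auto.
  - apply (ex_series_scal_l K (fun n => (2 * INR n + 1) ^ 3 * q ^ n)).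
    apply ex_series_cube_geom, Hq.
Qed.

Lemma one_le_cube n : 1 <= (2 * INR n + 1) ^ 3.
Proof. apply pow_R1_Rle. pose proof (pos_INR n). lra. Qed.

Lemma filterlim_shift_down i :
  filterlim (fun N => (N - i)%nat) eventually eventually.
Proof.
  intros P [n0 H]. exists (n0 + i)%nat. intros N HN. apply H. lia.
Qed.

Lemma eventually_le_filterlim (phi psi : nat -> nat) :
  (forall N, (phi N <= psi N)%nat) -> filterlim phi eventually eventually ->
  filterlim psi eventually eventually.
Proof.
  intros Hle H P [n0 HP].
  destruct (H (fun n => (n0 <= n)%nat)) as [N0 HN]; [exists n0; auto|].
  exists N0. intros N HN0. apply HP. specialize (HN N HN0). specialize (Hle N).
  simpl in HN. lia.
Qed.

Definition theta4_0 (q : R) : R :=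
  1 + 2 * Series (fun n => (-1) ^ S n * q ^ (S n * S n)).

Lemma theta_even_limit q z L : 0 < q < 1 -> 0 < L -> z * z = 1 ->
  is_lim_seq (qpoch (q ^ 2)) L -> (forall n, L <= qpoch (q ^ 2) n) ->
  is_lim_seq (fun N => (qprod (q ^ 2) N 1 (z * q)) ^ 2)
    (/ L * (1 + 2 * Series (fun n => z ^ S n * q ^ (S n * S n)))).
Proof.
  intros Hq HL0 Hz HL HLle.
  assert (Hp : 0 < q ^ 2 < 1) by (simpl; nra).
  assert (Hzn : forall n, Rabs (z ^ n) = 1).
  { intros n. rewrite <- RPow_abs.
    assert (Hz1 : Rabs z = 1).
    { destruct (Rmult_integral (z - 1) (z + 1)) as [H|H]; [nra| |].
      - replace z with 1 by lra. apply Rabs_R1.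
      - replace z with (- (1)) by lra. rewrite Rabs_Ropp. apply Rabs_R1. }
    rewrite Hz1. apply pow1. }
  assert (E1 : ex_series (fun i => Rabs (z ^ S i * q ^ (S i * S i)))).
  { apply (ex_series_poly_pow q (fun i => z ^ S i) (fun i => (S i * S i)%nat) 1 Hq).
    - intros n. rewrite Hzn. pose proof (one_le_cube n). lra.
    - intros n. nia. }
  assert (E2 : ex_series (fun i => Rabs (z ^ i * q ^ (i * i)))).
  { apply (ex_series_poly_pow q (fun i => z ^ i) (fun i => (i * i)%nat) 1 Hq).
    - intros n. rewrite Hzn. pose proof (one_le_cube n). lra.
    - intros n. nia. }
  apply (is_lim_seq_ext (fun N =>
    sum_f_R0 (fun i => gauss_binom (q ^ 2) (2 * N) (N + 1 + i) * (z ^ S i * q ^ (S i * S i))) N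
    + sum_f_R0 (fun i => gauss_binom (q ^ 2) (2 * N) (N - i) * (z ^ i * q ^ (i * i))) N)).
  { intros N. rewrite theta_even_finite by (assumption || lra).
    rewrite <- plus_sum. reflexivity. }
  replace (/ L * (1 + 2 * Series (fun n => z ^ S n * q ^ (S n * S n))))
    with (/ L * Series (fun i => z ^ S i * q ^ (S i * S i))
          + / L * Series (fun i => z ^ i * q ^ (i * i))).
  2:{ rewrite (Series_incr_1 (fun i => z ^ i * q ^ (i * i))) by (apply ex_series_Rabs, E2).
      simpl (z ^ 0 * q ^ (0 * 0)). ring. }
  apply is_lim_seq_plus'.
  - apply (gauss_sum_limit (q ^ 2) L (fun N => (2 * N)%nat) (fun N i => (N + 1 + i)%nat));
      try assumption.
    + intros i. apply (eventually_le_filterlim (fun N => (N - i)%nat)); [intros; lia|].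
      apply filterlim_shift_down.
    + intros i. apply (eventually_le_filterlim (fun N => (N - (1 + i))%nat)); [intros; lia|].
      apply filterlim_shift_down.
  - apply (gauss_sum_limit (q ^ 2) L (fun N => (2 * N)%nat) (fun N i => (N - i)%nat));
      try assumption.
    + intros i. apply filterlim_shift_down.
    + intros i. apply (eventually_le_filterlim (fun N => (N - i)%nat)); [intros; lia|].
      apply filterlim_shift_down.
Qed.

Lemma theta_odd_limit p L (c : nat -> R) : 0 < p < 1 -> 0 < L ->
  is_lim_seq (qpoch p) L -> (forall n, L <= qpoch p n) ->
  ex_series (fun i => Rabs (c i)) ->
  is_lim_seq (fun N => sum_f_R0 (fun i => gauss_binom p (2 * N + 1) (N - i) * c i) N)
    (/ L * Series c).
Proof.
  intros Hp HL0 HL HLle Hc.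
  apply (gauss_sum_limit p L (fun N => (2 * N + 1)%nat) (fun N i => (N - i)%nat));
    try assumption.
  - intros i. apply filterlim_shift_down.
  - intros i. apply (eventually_le_filterlim (fun N => (N - i)%nat)); [intros; lia|].
    apply filterlim_shift_down.
Qed.

Lemma pow_choose2 q n : (q ^ 2) ^ choose2 (S n) = q ^ (n * (n + 1)).
Proof. rewrite <- pow_mult. f_equal. pose proof (two_choose2 (S n)). lia. Qed.

(** By the finite forms, [theta_3], [theta_4], the series of [theta_2] and the alternating
    series on the left are [L] times the limits of the squares of the four products in
    [euler_finite], where [L] is the limit of [(q^2; q^2)_N].  As
    [(q^2; q^2)_N] and [(q^2; q^2)_(2N)] have the same limit [L], both sides of the
    identity are [L^3].  Positivity also follows: each constant is [L] times a limit of
    squares, and the product of the three is [L^3]. *)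
Theorem jacobi_theta_constants q : 0 < q < 1 ->
  0 < theta3_0 q /\ 0 < theta4_0 q /\ 0 < Series (fun n => q ^ (n * (n + 1))) /\
  Series (fun n => (-1) ^ n * (2 * INR n + 1) * q ^ (n * (n + 1))) =
  theta3_0 q * theta4_0 q * Series (fun n => q ^ (n * (n + 1))).
Proof.
  intros Hq.
  assert (Hp : 0 < q ^ 2 < 1) by (simpl; nra).
  destruct (qpoch_limit (q ^ 2) Hp) as (L & HL0 & HL & HLle).
  set (t2 := Series (fun n => q ^ (n * (n + 1)))).
  set (d := Series (fun n => (-1) ^ n * (2 * INR n + 1) * q ^ (n * (n + 1)))).
  assert (H3 : is_lim_seq (fun N => (qprod (q ^ 2) N 1 (1 * q)) ^ 2) (/ L * theta3_0 q)).
  { unfold theta3_0.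
    rewrite (Series_ext (fun n => q ^ (S n * S n)) (fun n => 1 ^ S n * q ^ (S n * S n))).
    - apply theta_even_limit; try assumption; ring.
    - intros n. rewrite pow1. ring. }
  assert (H4 : is_lim_seq (fun N => (qprod (q ^ 2) N 1 (-1 * q)) ^ 2) (/ L * theta4_0 q)).
  { apply theta_even_limit; try assumption; ring. }
  assert (H2 : is_lim_seq (fun N => (qprod (q ^ 2) N 1 (q ^ 2)) ^ 2) (/ L * t2)).
  { apply (is_lim_seq_ext (fun N =>
      sum_f_R0 (fun i => gauss_binom (q ^ 2) (2 * N + 1) (N - i) * q ^ (i * (i + 1))) N)).
    - intros N. rewrite theta2_finite by exact Hp.
      apply sum_eq; intros i _. rewrite pow_choose2. reflexivity.
    - apply theta_odd_limit; try assumption.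
      apply (ex_series_ext (fun n => Rabs (1 * q ^ (n * (n + 1))))).
      { intros n. rewrite Rmult_1_l. reflexivity. }
      apply (ex_series_poly_pow q (fun _ => 1) (fun n => (n * (n + 1))%nat) 1 Hq).
      + intros n. rewrite Rabs_R1. pose proof (one_le_cube n). lra.
      + intros n. nia. }
  assert (Hd : is_lim_seq (fun N => (qpoch (q ^ 2) N) ^ 2) (/ L * d)).
  { apply (is_lim_seq_ext (fun N =>
      sum_f_R0 (fun i => gauss_binom (q ^ 2) (2 * N + 1) (N - i)
        * ((-1) ^ i * (2 * INR i + 1) * q ^ (i * (i + 1)))) N)).
    - intros N. rewrite jacobi_cube_finite by exact Hp.
      apply sum_eq; intros i _. rewrite pow_choose2. reflexivity.
    - apply theta_odd_limit; try assumption.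
      apply (ex_series_poly_pow q (fun n => (-1) ^ n * (2 * INR n + 1))
               (fun n => (n * (n + 1))%nat) 1 Hq).
      + intros n. rewrite Rabs_mult, pow_1_abs. pose proof (pos_INR n).
        rewrite Rabs_pos_eq by lra. rewrite !Rmult_1_l.
        rewrite <- (pow_1 (2 * INR n + 1)) at 1. apply Rle_pow; [lra|lia].
      + intros n. nia. }
  assert (Hsq : is_lim_seq (fun N => (qpoch (q ^ 2) N) ^ 2) (L * L)).
  { apply (is_lim_seq_ext (fun N => qpoch (q ^ 2) N * qpoch (q ^ 2) N)).
    - intros; ring.
    - apply is_lim_seq_mult'; exact HL. }
  assert (Ed : / L * d = L * L).
  { apply is_lim_seq_unique in Hd. apply is_lim_seq_unique in Hsq.
    rewrite Hd in Hsq. injection Hsq; auto. }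
  assert (Eprod : / L * theta3_0 q * (/ L * theta4_0 q) * (/ L * t2) * (L * L) = L * L).
  { assert (Ha := is_lim_seq_mult' _ _ _ _
      (is_lim_seq_mult' _ _ _ _ (is_lim_seq_mult' _ _ _ _ H3 H4) H2) Hsq).
    assert (Hb : is_lim_seq (fun N => qpoch (q ^ 2) (2 * N) * qpoch (q ^ 2) (2 * N)) (L * L)).
    { assert (is_lim_seq (fun N => qpoch (q ^ 2) (2 * N)) L).
      { apply (is_lim_seq_subseq (qpoch (q ^ 2)) L (fun N => (2 * N)%nat)); [|exact HL].
        apply (eventually_le_filterlim (fun N => (N - 0)%nat)); [intros; lia|].
        apply filterlim_shift_down. }
      apply is_lim_seq_mult'; assumption. }
    apply (is_lim_seq_ext _ (fun N => qpoch (q ^ 2) (2 * N) * qpoch (q ^ 2) (2 * N))) in Ha.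
    - apply is_lim_seq_unique in Ha. apply is_lim_seq_unique in Hb.
      rewrite Hb in Ha. injection Ha; auto.
    - intros N. rewrite <- euler_finite. ring. }
  assert (Eq3 : theta3_0 q * theta4_0 q * t2 = L * L * L).
  { apply (Rmult_eq_reg_l (/ L * / L * / L * (L * L))).
    - transitivity (L * L); [etransitivity; [|exact Eprod]; ring|field; lra].
    - apply Rgt_not_eq. assert (0 < / L) by (apply Rinv_0_lt_compat; lra).
      repeat apply Rmult_lt_0_compat; lra. }
  assert (Hnn : forall (u : nat -> R) x,
    is_lim_seq (fun N => u N ^ 2) (/ L * x) -> 0 <= x).
  { intros u x Hx. apply (Rmult_le_reg_l (/ L)); [apply Rinv_0_lt_compat; lra|].
    rewrite Rmult_0_r.
    apply (is_lim_seq_le (fun _ => 0) (fun N => u N ^ 2) 0 (/ L * x)).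
    - intros N. apply pow2_ge_0.
    - apply is_lim_seq_const.
    - exact Hx. }
  apply Hnn in H3, H4, H2.
  assert (0 < theta3_0 q * theta4_0 q * t2) by (rewrite Eq3; repeat apply Rmult_lt_0_compat; lra).
  assert (theta3_0 q <> 0) by (intros E; rewrite E in *; lra).
  assert (theta4_0 q <> 0) by (intros E; rewrite E in *; lra).
  assert (t2 <> 0) by (intros E; rewrite E in *; lra).
  repeat split; try lra.
  - rewrite Eq3. apply (Rmult_eq_reg_l (/ L)).
    + rewrite Ed. field. lra.
    + apply Rinv_neq_0_compat. lra.
Qed.

(** * Theta functions and sn on the real axis *)

Lemma lipschitz_1 (f df : R -> R) a b :
  (forall x, is_derive f x (df x)) -> (forall x, Rabs (df x) <= 1) ->
  Rabs (f b - f a) <= Rabs (b - a).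
Proof.
  intros Hd Hb.
  destruct (MVT_gen f a b df) as (c & _ & E).
  - intros x _. apply Hd.
  - intros x _. apply derivable_continuous_pt. exists (df x).
    apply is_derive_Reals, Hd.
  - rewrite E, Rabs_mult. pose proof (Hb c). pose proof (Rabs_pos (b - a)). nra.
Qed.

Lemma sin_lipschitz a b : Rabs (sin b - sin a) <= Rabs (b - a).
Proof.
  apply (lipschitz_1 sin cos).
  - intros x. auto_derive; [trivial|ring].
  - intros x. apply Rabs_le, COS_bound.
Qed.

Lemma cos_lipschitz a b : Rabs (cos b - cos a) <= Rabs (b - a).
Proof.
  apply (lipschitz_1 cos (fun x => - sin x)).
  - intros x. auto_derive; [trivial|ring].
  - intros x. rewrite Rabs_Ropp. apply Rabs_le, SIN_bound.
Qed.

Lemma cos_minus_1_bound y : Rabs (cos y - 1) <= Rabs y ^ 2.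
Proof.
  replace y with (2 * (y / 2)) at 1 by field. rewrite cos_2a_sin.
  pose proof (sin_lipschitz 0 (y / 2)) as H. rewrite sin_0, !Rminus_0_r in H.
  replace (1 - 2 * sin (y / 2) * sin (y / 2) - 1) with (- (2 * (sin (y / 2) * sin (y / 2)))) by ring.
  rewrite Rabs_Ropp, Rabs_mult, Rabs_mult, (Rabs_pos_eq 2) by lra.
  replace (Rabs y) with (2 * Rabs (y / 2)).
  2:{ rewrite <- (Rabs_pos_eq 2) at 1 by lra. rewrite <- Rabs_mult. f_equal. field. }
  pose proof (Rabs_pos (sin (y / 2))). simpl. nra.
Qed.

Lemma sin_minus_id_bound y : Rabs (sin y - y) <= Rabs y ^ 3.
Proof.
  destruct (MVT_gen (fun x => sin x - x) 0 y (fun x => cos x - 1)) as (c & Hc & E).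
  - intros x _. auto_derive; [trivial|ring].
  - intros x _. apply derivable_continuous_pt. exists (cos x - 1).
    apply is_derive_Reals. auto_derive; [trivial|ring].
  - rewrite sin_0, !Rminus_0_r in E. rewrite E, Rabs_mult.
    pose proof (cos_minus_1_bound c) as H1.
    assert (H2 : Rabs c <= Rabs y).
    { unfold Rmin, Rmax in Hc. destruct (Rle_dec 0 y).
      - rewrite !Rabs_pos_eq by lra. lra.
      - rewrite !Rabs_left1 by lra. lra. }
    pose proof (Rabs_pos c). pose proof (Rabs_pos y).
    assert (Rabs c ^ 2 <= Rabs y ^ 2) by (apply pow_incr; lra).
    simpl in *. nra.
Qed.

(** The form in which Lipschitz and Taylor bounds pass from the terms to the sums. *)
Lemma Series_close (u v b : nat -> R) c :
  (forall n, Rabs (u n - v n) <= c * b n) ->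
  ex_series u -> ex_series v -> ex_series b ->
  Rabs (Series u - Series v) <= c * Series b.
Proof.
  intros H Hu Hv Hb.
  rewrite <- Series_minus, <- Series_scal_l by assumption.
  assert (E : ex_series (fun n => c * b n)) by (apply (ex_series_scal_l c b), Hb).
  eapply Rle_trans; [apply Series_Rabs|apply Series_le].
  - apply (ex_series_le (fun n => Rabs (u n - v n)) (fun n => c * b n)); [|exact E].
    intros n. change (Rabs (Rabs (u n - v n)) <= c * b n). rewrite Rabs_Rabsolu. apply H.
  - intros n. split; [apply Rabs_pos|apply H].
  - exact E.
Qed.

(** The restriction of [theta1] to the real axis. *)
Definition rtheta1 (q x : R) : R :=
  2 * Series (fun n => (-1) ^ n * Rpower q ((INR n + 1 / 2) ^ 2)
                       * sin (INR (2 * n + 1) * x)).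

(** The restriction of [theta4] to the real axis. *)
Definition rtheta4 (q x : R) : R :=
  1 + 2 * Series (fun n => (-1) ^ S n * q ^ (S n * S n) * cos (INR (2 * S n) * x)).

Lemma Csin_RtoC x : Csin (RtoC x) = RtoC (sin x).
Proof.
  unfold Csin, RtoC; simpl. rewrite cosh_0, sinh_0. f_equal; ring.
Qed.

Lemma Ccos_RtoC x : Ccos (RtoC x) = RtoC (cos x).
Proof.
  unfold Ccos, RtoC; simpl. rewrite cosh_0, sinh_0. f_equal; ring.
Qed.

Lemma CSeries_RtoC (a : nat -> C) (b : nat -> R) :
  (forall n, a n = RtoC (b n)) -> CSeries a = RtoC (Series b).
Proof.
  intros H. unfold CSeries, RtoC. f_equal.
  - apply Series_ext. intros n. rewrite H. reflexivity.
  - rewrite (Series_ext _ (fun n => 0 * b n)), Series_scal_l; [ring|].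
    intros n. rewrite H. simpl. ring.
Qed.

Lemma theta1_RtoC q x : theta1 q (RtoC x) = RtoC (rtheta1 q x).
Proof.
  unfold theta1, rtheta1.
  rewrite (CSeries_RtoC _ (fun n => (-1) ^ n * Rpower q ((INR n + 1 / 2) ^ 2)
                       * sin (INR (2 * n + 1) * x))).
  - symmetry; apply RtoC_mult.
  - intros n. rewrite <- RtoC_mult, Csin_RtoC, <- RtoC_mult. reflexivity.
Qed.

Lemma theta4_RtoC q x : theta4 q (RtoC x) = RtoC (rtheta4 q x).
Proof.
  unfold theta4, rtheta4.
  rewrite (CSeries_RtoC _ (fun n => (-1) ^ S n * q ^ (S n * S n) * cos (INR (2 * S n) * x))).
  - rewrite RtoC_plus, RtoC_mult. reflexivity.
  - intros n. rewrite <- RtoC_mult, Ccos_RtoC, <- RtoC_mult. reflexivity.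
Qed.

(** Holds for [b = 0] too, since both inverses of 0 are 0; so no nonvanishing has to be known
    to descend from complex to real quotients. *)
Lemma Cdiv_RtoC a b : (RtoC a / RtoC b)%C = RtoC (a / b).
Proof.
  destruct (Req_dec b 0) as [->|Hb].
  - unfold RtoC, Cdiv, Cinv, Cmult, Rdiv; simpl.
    replace (0 * (0 * 1) + 0 * (0 * 1)) with 0 by ring. rewrite Rinv_0. f_equal; ring.
  - symmetry. apply RtoC_div. exact Hb.
Qed.

Lemma Rpower_half_square q n : 0 < q ->
  Rpower q ((INR n + 1 / 2) ^ 2) = Rpower q (1 / 4) * q ^ (n * (n + 1)).
Proof.
  intros Hq. rewrite <- (Rpower_pow (n * (n + 1)) q Hq). rewrite <- Rpower_plus. f_equal.
  rewrite mult_INR, plus_INR. simpl. field.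
Qed.

Lemma rtheta1_eq q x : 0 < q ->
  rtheta1 q x = 2 * Rpower q (1 / 4)
    * Series (fun n => (-1) ^ n * sin (INR (2 * n + 1) * x) * q ^ (n * (n + 1))).
Proof.
  intros Hq. unfold rtheta1. rewrite Rmult_assoc, <- (Series_scal_l (Rpower q (1 / 4))). f_equal.
  apply Series_ext. intros n. rewrite Rpower_half_square by exact Hq. ring.
Qed.

Lemma theta2_0_eq q : 0 < q ->
  theta2_0 q = 2 * Rpower q (1 / 4) * Series (fun n => q ^ (n * (n + 1))).
Proof.
  intros Hq. unfold theta2_0. rewrite Rmult_assoc, <- (Series_scal_l (Rpower q (1 / 4))). f_equal.
  apply Series_ext. intros n. apply Rpower_half_square, Hq.
Qed.

Lemma INR_odd n : INR (2 * n + 1) = 2 * INR n + 1.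
Proof. rewrite plus_INR, mult_INR. simpl. ring. Qed.

Lemma INR_even n : INR (2 * S n) = 2 * INR n + 2.
Proof. rewrite mult_INR, (S_INR n). simpl (INR 2). ring. Qed.

Lemma ex_series_signed_pow q (s : nat -> R) (e : nat -> nat) K : 0 < q < 1 ->
  (forall n, Rabs (s n) <= K * (2 * INR n + 1) ^ 3) -> (forall n, (n <= e n)%nat) ->
  ex_series (fun n => s n * q ^ e n).
Proof.
  intros Hq Hs He. apply ex_series_Rabs. apply (ex_series_poly_pow q s e K); assumption.
Qed.

Lemma Rabs_sign_mult n x : Rabs ((-1) ^ n * x) = Rabs x.
Proof. rewrite Rabs_mult, pow_1_abs. ring. Qed.

Lemma le_cube n x : 0 <= x <= 1 -> x <= 1 * (2 * INR n + 1) ^ 3.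
Proof. intros Hx. pose proof (one_le_cube n). lra. Qed.

Lemma ex_series_rtheta1 q x : 0 < q < 1 ->
  ex_series (fun n => (-1) ^ n * sin (INR (2 * n + 1) * x) * q ^ (n * (n + 1))).
Proof.
  intros Hq.
  apply (ex_series_signed_pow q (fun n => (-1) ^ n * sin (INR (2 * n + 1) * x))
           (fun n => (n * (n + 1))%nat) 1 Hq).
  - intros n. rewrite Rabs_sign_mult. apply le_cube. split; [apply Rabs_pos|].
    apply Rabs_le, SIN_bound.
  - intros n. nia.
Qed.

Lemma ex_series_rtheta4 q x : 0 < q < 1 ->
  ex_series (fun n => (-1) ^ S n * cos (INR (2 * S n) * x) * q ^ (S n * S n)).
Proof.
  intros Hq.
  apply (ex_series_signed_pow q (fun n => (-1) ^ S n * cos (INR (2 * S n) * x))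
           (fun n => (S n * S n)%nat) 1 Hq).
  - intros n. rewrite Rabs_sign_mult. apply le_cube. split; [apply Rabs_pos|].
    apply Rabs_le, COS_bound.
  - intros n. nia.
Qed.

Lemma ex_series_odd_pow q j : 0 < q < 1 -> (j <= 3)%nat ->
  ex_series (fun n => INR (2 * n + 1) ^ j * q ^ (n * (n + 1))).
Proof.
  intros Hq Hj.
  apply (ex_series_signed_pow q (fun n => INR (2 * n + 1) ^ j)
           (fun n => (n * (n + 1))%nat) 1 Hq).
  - intros n. rewrite INR_odd. pose proof (pos_INR n).
    rewrite Rabs_pos_eq by (apply pow_le; lra). rewrite Rmult_1_l.
    apply Rle_pow; [lra|exact Hj].
  - intros n. nia.
Qed.

Lemma ex_series_even_pow q j : 0 < q < 1 -> (j <= 3)%nat ->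
  ex_series (fun n => INR (2 * S n) ^ j * q ^ (S n * S n)).
Proof.
  intros Hq Hj.
  apply (ex_series_signed_pow q (fun n => INR (2 * S n) ^ j)
           (fun n => (S n * S n)%nat) (2 ^ 3) Hq).
  - intros n. rewrite INR_even. pose proof (pos_INR n).
    rewrite Rabs_pos_eq by (apply pow_le; lra). rewrite <- Rpow_mult_distr.
    apply Rle_trans with ((2 * INR n + 2) ^ 3).
    + apply Rle_pow; [lra|exact Hj].
    + apply pow_incr. lra.
  - intros n. nia.
Qed.

Lemma abs_term_bound n s w Q : 0 <= Q -> Rabs s <= w -> Rabs ((-1) ^ n * s * Q) <= w * Q.
Proof.
  intros HQ Hs. rewrite Rabs_mult, Rabs_sign_mult, (Rabs_pos_eq Q) by exact HQ.
  apply Rmult_le_compat_r; assumption.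
Qed.

Lemma rtheta1_lipschitz q : 0 < q < 1 ->
  exists K, forall x y, Rabs (rtheta1 q x - rtheta1 q y) <= K * Rabs (x - y).
Proof.
  intros Hq.
  exists (2 * Rpower q (1 / 4) * Series (fun n => INR (2 * n + 1) ^ 1 * q ^ (n * (n + 1)))).
  intros x y. rewrite !rtheta1_eq by lra.
  assert (H0 : 0 < Rpower q (1 / 4)) by apply exp_pos.
  rewrite <- Rmult_minus_distr_l, Rabs_mult, Rabs_pos_eq,
    (Rmult_assoc (2 * Rpower q (1 / 4))) by lra.
  apply Rmult_le_compat_l; [lra|]. rewrite Rmult_comm.
  apply Series_close; try (apply ex_series_rtheta1; assumption);
    [|apply ex_series_odd_pow; [assumption|lia]].
  intros n. rewrite <- Rmult_minus_distr_r, <- Rmult_minus_distr_l, <- Rmult_assoc.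
  apply abs_term_bound; [apply pow_le; lra|].
  eapply Rle_trans; [apply sin_lipschitz|].
  rewrite <- Rmult_minus_distr_l, Rabs_mult, (Rabs_pos_eq (INR _)) by apply pos_INR.
  rewrite pow_1. lra.
Qed.

Lemma rtheta4_lipschitz q : 0 < q < 1 ->
  exists K, forall x y, Rabs (rtheta4 q x - rtheta4 q y) <= K * Rabs (x - y).
Proof.
  intros Hq.
  assert (E : forall x, rtheta4 q x =
    1 + 2 * Series (fun n => (-1) ^ S n * cos (INR (2 * S n) * x) * q ^ (S n * S n))).
  { intros x. unfold rtheta4. do 2 f_equal. apply Series_ext; intros; ring. }
  exists (2 * Series (fun n => INR (2 * S n) ^ 1 * q ^ (S n * S n))).
  intros x y. rewrite !E.
  match goal with |- Rabs (1 + 2 * ?a - (1 + 2 * ?b)) <= _ =>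
    replace (1 + 2 * a - (1 + 2 * b)) with (2 * (a - b)) by ring end.
  rewrite Rabs_mult, Rabs_pos_eq, Rmult_assoc by lra.
  apply Rmult_le_compat_l; [lra|]. rewrite Rmult_comm.
  apply Series_close; try (apply ex_series_rtheta4; assumption);
    [|apply ex_series_even_pow; [assumption|lia]].
  intros n. rewrite <- Rmult_minus_distr_r, <- Rmult_minus_distr_l, <- Rmult_assoc.
  apply abs_term_bound; [apply pow_le; lra|].
  eapply Rle_trans; [apply cos_lipschitz|].
  rewrite <- Rmult_minus_distr_l, Rabs_mult, (Rabs_pos_eq (INR _)) by apply pos_INR.
  rewrite pow_1. lra.
Qed.

(** The linear coefficient is the alternating series of [jacobi_theta_constants]. *)
Lemma rtheta1_expansion q : 0 < q < 1 ->
  exists K, forall x, Rabs (rtheta1 q x - theta2_0 q * theta3_0 q * theta4_0 q * x)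
                      <= K * Rabs x ^ 3.
Proof.
  intros Hq.
  exists (2 * Rpower q (1 / 4) * Series (fun n => INR (2 * n + 1) ^ 3 * q ^ (n * (n + 1)))).
  intros x. rewrite rtheta1_eq, theta2_0_eq by lra.
  destruct (jacobi_theta_constants q Hq) as (_ & _ & _ & HJ).
  assert (H0 : 0 < Rpower q (1 / 4)) by apply exp_pos.
  match goal with |- Rabs (?c * ?a - ?c * ?t * ?u * ?v * x) <= _ =>
    replace (c * a - c * t * u * v * x) with (c * (a - x * (u * v * t))) by ring end.
  rewrite <- HJ, <- (Series_scal_l x).
  rewrite Rabs_mult, Rabs_pos_eq, (Rmult_assoc (2 * Rpower q (1 / 4))) by lra.
  apply Rmult_le_compat_l; [lra|]. rewrite Rmult_comm.
  apply Series_close.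
  - intros n.
    replace ((-1) ^ n * sin (INR (2 * n + 1) * x) * q ^ (n * (n + 1))
             - x * ((-1) ^ n * (2 * INR n + 1) * q ^ (n * (n + 1))))
      with ((-1) ^ n * (sin (INR (2 * n + 1) * x) - INR (2 * n + 1) * x) * q ^ (n * (n + 1)))
      by (rewrite INR_odd; ring).
    rewrite <- Rmult_assoc.
    apply abs_term_bound; [apply pow_le; lra|].
    eapply Rle_trans; [apply sin_minus_id_bound|].
    rewrite Rabs_mult, (Rabs_pos_eq (INR _)), Rpow_mult_distr by apply pos_INR. lra.
  - apply ex_series_rtheta1, Hq.
  - apply (ex_series_scal_l x (fun n => (-1) ^ n * (2 * INR n + 1) * q ^ (n * (n + 1)))).
    apply (ex_series_signed_pow q (fun n => (-1) ^ n * (2 * INR n + 1))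
             (fun n => (n * (n + 1))%nat) 1 Hq).
    + intros n. rewrite Rabs_sign_mult. pose proof (pos_INR n).
      rewrite Rabs_pos_eq by lra. rewrite Rmult_1_l.
      rewrite <- (pow_1 (2 * INR n + 1)) at 1. apply Rle_pow; [lra|lia].
    + intros n. nia.
  - apply ex_series_odd_pow; [assumption|lia].
Qed.

Lemma rtheta4_expansion q : 0 < q < 1 ->
  exists K, forall x, Rabs (rtheta4 q x - theta4_0 q) <= K * Rabs x ^ 2.
Proof.
  intros Hq.
  exists (2 * Series (fun n => INR (2 * S n) ^ 2 * q ^ (S n * S n))).
  intros x.
  replace (rtheta4 q x) with
    (1 + 2 * Series (fun n => (-1) ^ S n * cos (INR (2 * S n) * x) * q ^ (S n * S n))).
  2:{ unfold rtheta4. do 2 f_equal. apply Series_ext; intros; ring. }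
  unfold theta4_0.
  match goal with |- Rabs (1 + 2 * ?a - (1 + 2 * ?b)) <= _ =>
    replace (1 + 2 * a - (1 + 2 * b)) with (2 * (a - b)) by ring end.
  rewrite Rabs_mult, Rabs_pos_eq, Rmult_assoc by lra.
  apply Rmult_le_compat_l; [lra|]. rewrite Rmult_comm.
  apply Series_close.
  - intros n.
    replace ((-1) ^ S n * cos (INR (2 * S n) * x) * q ^ (S n * S n)
             - (-1) ^ S n * q ^ (S n * S n))
      with ((-1) ^ S n * (cos (INR (2 * S n) * x) - 1) * q ^ (S n * S n)) by ring.
    rewrite <- Rmult_assoc.
    apply abs_term_bound; [apply pow_le; lra|].
    eapply Rle_trans; [apply cos_minus_1_bound|].
    rewrite Rabs_mult, (Rabs_pos_eq (INR _)), Rpow_mult_distr by apply pos_INR. lra.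
  - apply ex_series_rtheta4, Hq.
  - apply (ex_series_signed_pow q (fun n => (-1) ^ S n)
             (fun n => (S n * S n)%nat) 1 Hq).
    + intros n. rewrite pow_1_abs. apply le_cube. lra.
    + intros n. nia.
  - apply ex_series_even_pow; [assumption|lia].
Qed.

Lemma continuity_of_lipschitz f K :
  (forall x y, Rabs (f x - f y) <= K * Rabs (x - y)) -> continuity f.
Proof.
  intros H x eps Heps.
  assert (HK : 0 < Rabs K + 1) by (pose proof (Rabs_pos K); lra).
  exists (eps / (Rabs K + 1)). split; [apply Rdiv_lt_0_compat; lra|].
  intros y [_ Hy]. simpl in *. unfold Rdist in *.
  eapply Rle_lt_trans; [apply H|].
  pose proof (Rle_abs K). pose proof (Rabs_pos (y - x)).
  apply Rle_lt_trans with ((Rabs K + 1) * Rabs (y - x)); [nra|].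
  apply (Rmult_lt_compat_l (Rabs K + 1)) in Hy; [|lra].
  replace ((Rabs K + 1) * (eps / (Rabs K + 1))) with eps in Hy by (field; lra). exact Hy.
Qed.

Lemma rtheta1_half_PI q : rtheta1 q (PI / 2) = theta2_0 q.
Proof.
  unfold rtheta1, theta2_0. f_equal. apply Series_ext. intros n.
  replace (sin (INR (2 * n + 1) * (PI / 2))) with ((-1) ^ n).
  - transitivity (Rpower q ((INR n + 1 / 2) ^ 2) * ((-1) ^ n * (-1) ^ n)); [ring|].
    rewrite <- Rpow_mult_distr. replace (-1 * -1) with 1 by ring. rewrite pow1. ring.
  - rewrite INR_odd. induction n as [|n IH].
    + transitivity (sin (PI / 2)); [symmetry; apply sin_PI2|f_equal; simpl; field].
    + rewrite S_INR. replace ((2 * (INR n + 1) + 1) * (PI / 2))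
        with ((2 * INR n + 1) * (PI / 2) + PI) by field.
      rewrite neg_sin, <- IH. simpl. ring.
Qed.

Lemma rtheta4_half_PI q : rtheta4 q (PI / 2) = theta3_0 q.
Proof.
  unfold rtheta4, theta3_0. do 2 f_equal. apply Series_ext. intros n.
  replace (cos (INR (2 * S n) * (PI / 2))) with ((-1) ^ S n).
  - transitivity (q ^ (S n * S n) * ((-1) ^ S n * (-1) ^ S n)); [ring|].
    rewrite <- Rpow_mult_distr. replace (-1 * -1) with 1 by ring. rewrite pow1. ring.
  - rewrite INR_even. induction n as [|n IH].
    + transitivity (cos PI); [rewrite cos_PI; simpl; ring|f_equal; simpl; field].
    + rewrite S_INR. replace ((2 * (INR n + 1) + 2) * (PI / 2))
        with ((2 * INR n + 2) * (PI / 2) + PI) by field.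
      rewrite neg_cos, <- IH. simpl. ring.
Qed.

Lemma rtheta1_odd q x : rtheta1 q (- x) = - rtheta1 q x.
Proof.
  unfold rtheta1. rewrite Ropp_mult_distr_r, <- Series_opp. f_equal.
  apply Series_ext. intros n. rewrite <- Ropp_mult_distr_r, sin_neg. ring.
Qed.

Lemma rtheta4_even q x : rtheta4 q (- x) = rtheta4 q x.
Proof.
  unfold rtheta4. do 2 f_equal. apply Series_ext. intros n.
  rewrite <- Ropp_mult_distr_r, cos_neg. reflexivity.
Qed.

Lemma rtheta4_0 q : rtheta4 q 0 = theta4_0 q.
Proof.
  unfold rtheta4, theta4_0. do 2 f_equal. apply Series_ext. intros n.
  rewrite Rmult_0_r, cos_0. ring.
Qed.

Lemma rtheta1_0 q : rtheta1 q 0 = 0.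
Proof.
  pose proof (rtheta1_odd q 0) as H. rewrite Ropp_0 in H. lra.
Qed.

Lemma theta2_0_pos q : 0 < q < 1 -> 0 < theta2_0 q.
Proof.
  intros Hq. rewrite theta2_0_eq by lra.
  destruct (jacobi_theta_constants q Hq) as (_ & _ & H & _).
  assert (0 < Rpower q (1 / 4)) by apply exp_pos.
  repeat apply Rmult_lt_0_compat; lra.
Qed.

(** The difference of the two sides is negative at 0, where [rtheta1] vanishes, and positive
    at [PI / 2], where the theta functions become [theta_2] and [theta_3].  Stated as a
    product rather than a quotient, it needs no information on the zeros of [rtheta4]. *)
Lemma theta_ratio_surj_pos q c : 0 < q < 1 -> 0 < c < 1 ->
  exists x, 0 < x < PI / 2 /\
    rtheta1 q x = c * (theta2_0 q / theta3_0 q) * rtheta4 q x.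
Proof.
  intros Hq Hc.
  destruct (jacobi_theta_constants q Hq) as (H3 & H4 & _ & _).
  pose proof (theta2_0_pos q Hq) as H2.
  set (F := fun x => rtheta1 q x - c * (theta2_0 q / theta3_0 q) * rtheta4 q x).
  assert (HF : continuity F).
  { destruct (rtheta1_lipschitz q Hq) as [K1 HK1].
    destruct (rtheta4_lipschitz q Hq) as [K4 HK4].
    apply (continuity_minus (rtheta1 q)
             (fun x => c * (theta2_0 q / theta3_0 q) * rtheta4 q x)).
    - apply (continuity_of_lipschitz _ K1), HK1.
    - apply (continuity_scal (rtheta4 q)). apply (continuity_of_lipschitz _ K4), HK4. }
  assert (H23 : 0 < theta2_0 q / theta3_0 q) by (apply Rdiv_lt_0_compat; assumption).
  assert (HF0 : F 0 < 0).
  { unfold F. rewrite rtheta1_0, rtheta4_0.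
    assert (0 < c * (theta2_0 q / theta3_0 q) * theta4_0 q)
      by (apply Rmult_lt_0_compat; [apply Rmult_lt_0_compat|]; lra). lra. }
  assert (HF1 : 0 < F (PI / 2)).
  { unfold F. rewrite rtheta1_half_PI, rtheta4_half_PI.
    replace (theta2_0 q - c * (theta2_0 q / theta3_0 q) * theta3_0 q)
      with ((1 - c) * theta2_0 q) by (field; lra).
    apply Rmult_lt_0_compat; lra. }
  pose proof PI_RGT_0.
  destruct (IVT F 0 (PI / 2) HF ltac:(lra) HF0 HF1) as (x & Hx & E).
  exists x. split; [|unfold F in E; lra].
  split.
  - destruct (Req_dec x 0) as [->|]; lra.
  - destruct (Req_dec x (PI / 2)) as [->|]; lra.
Qed.

Lemma theta_ratio_surj q c : 0 < q < 1 -> -1 < c < 1 -> c <> 0 ->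
  exists x, - (PI / 2) < x < PI / 2 /\ 0 < x * c /\
    rtheta1 q x = c * (theta2_0 q / theta3_0 q) * rtheta4 q x.
Proof.
  intros Hq Hc Hc0. destruct (Rtotal_order c 0) as [H|[H|H]]; [|contradiction|].
  - destruct (theta_ratio_surj_pos q (- c) Hq ltac:(lra)) as (x & Hx & E).
    exists (- x). split; [lra|].
    split; [replace (- x * c) with (x * - c) by ring; apply Rmult_lt_0_compat; lra|].
    rewrite rtheta1_odd, rtheta4_even, E. ring.
  - destruct (theta_ratio_surj_pos q c Hq ltac:(lra)) as (x & Hx & E).
    exists x. split; [lra|]. split; [apply Rmult_lt_0_compat; lra|exact E].
Qed.

(** The restriction of [jacobi_sn] to the real axis; [PI / (2 K)] is [1 / theta_3^2] and
    the square root of the modulus is [theta_2 / theta_3]. *)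
Definition rsn (q u : R) : R :=
  theta3_0 q / theta2_0 q
  * (rtheta1 q (u / theta3_0 q ^ 2) / rtheta4 q (u / theta3_0 q ^ 2)).

Lemma jacobi_sn_RtoC q u : 0 < q < 1 -> jacobi_sn q (RtoC u) = RtoC (rsn q u).
Proof.
  intros Hq. unfold jacobi_sn, rsn.
  destruct (jacobi_theta_constants q Hq) as (H3 & _ & _ & _).
  pose proof (theta2_0_pos q Hq) as H2. pose proof PI_RGT_0.
  rewrite <- RtoC_mult, theta1_RtoC, theta4_RtoC, Cdiv_RtoC, <- RtoC_mult.
  replace (PI / (2 * ellK q) * u) with (u / theta3_0 q ^ 2)
    by (unfold ellK; field; lra).
  f_equal. f_equal. unfold modulus.
  replace (theta2_0 q ^ 2 / theta3_0 q ^ 2) with (Rsqr (theta2_0 q / theta3_0 q))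
    by (unfold Rsqr; field; lra).
  rewrite sqrt_Rsqr by (apply Rlt_le, Rdiv_lt_0_compat; assumption).
  field. lra.
Qed.

(** The leading coefficient is 1 by [rtheta1_expansion], and there is no quadratic term
    because [rtheta1] is odd and [rtheta4] even. *)
Lemma rsn_expansion q : 0 < q < 1 ->
  exists K d, 0 < d /\ forall u, Rabs u < d -> Rabs (rsn q u - u) <= K * Rabs u ^ 3.
Proof.
  intros Hq.
  destruct (jacobi_theta_constants q Hq) as (H3 & H4 & _ & _).
  pose proof (theta2_0_pos q Hq) as H2.
  destruct (rtheta1_expansion q Hq) as [K1 HK1].
  destruct (rtheta4_expansion q Hq) as [K4 HK4].
  set (a2 := theta2_0 q) in *. set (a3 := theta3_0 q) in *. set (a4 := theta4_0 q) in *.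
  assert (H33 : 0 < a3 ^ 2) by (apply pow_lt; lra).
  set (D := a4 / (2 * (Rabs K4 + 1))).
  assert (HK4' : 0 < Rabs K4 + 1) by (pose proof (Rabs_pos K4); lra).
  assert (HD : 0 < D) by (apply Rdiv_lt_0_compat; lra).
  exists ((a3 / a2) * ((Rabs K1 + a2 * a3 * (Rabs K4 + 1)) / (a4 / 2)) * / (a3 ^ 2) ^ 3),
    (a3 ^ 2 * Rmin 1 D).
  assert (Hm : 0 < Rmin 1 D) by (apply Rmin_pos; lra).
  split; [apply Rmult_lt_0_compat; assumption|].
  intros u Hu. unfold rsn. fold a2 a3.
  set (x := u / a3 ^ 2).
  assert (Ex : u = a3 ^ 2 * x) by (unfold x; field; lra).
  assert (Hx : Rabs x < Rmin 1 D).
  { rewrite Ex, Rabs_mult, (Rabs_pos_eq (a3 ^ 2)) in Hu by lra.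
    apply Rmult_lt_reg_l in Hu; assumption. }
  clearbody x. subst u.
  pose proof (Rmin_l 1 D). pose proof (Rmin_r 1 D).
  specialize (HK1 x). specialize (HK4 x). fold a4 in HK4.
  set (r1 := rtheta1 q x - a2 * a3 * a4 * x) in *.
  set (r4 := rtheta4 q x - a4) in *.
  replace (rtheta1 q x) with (a2 * a3 * a4 * x + r1) by (unfold r1; ring).
  replace (rtheta4 q x) with (a4 + r4) by (unfold r4; ring).
  clearbody r1 r4. pose proof (Rabs_pos x) as Hx0.
  assert (Hr4 : Rabs r4 <= (Rabs K4 + 1) * Rabs x ^ 2).
  { eapply Rle_trans; [apply HK4|]. apply Rmult_le_compat_r; [apply pow_le; lra|].
    pose proof (Rle_abs K4). lra. }
  assert (Hr4' : Rabs r4 <= a4 / 2).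
  { eapply Rle_trans; [apply Hr4|].
    apply Rle_trans with ((Rabs K4 + 1) * D); [|unfold D; apply Req_le; field; lra].
    apply Rmult_le_compat_l; [lra|]. simpl. nra. }
  assert (Hr1 : Rabs r1 <= Rabs K1 * Rabs x ^ 3).
  { eapply Rle_trans; [apply HK1|]. apply Rmult_le_compat_r; [apply pow_le; lra|].
    apply Rle_abs. }
  assert (Hden : a4 / 2 <= a4 + r4).
  { apply Rabs_le_between in Hr4'. lra. }
  replace (a3 / a2 * ((a2 * a3 * a4 * x + r1) / (a4 + r4)) - a3 ^ 2 * x)
    with (a3 / a2 * ((r1 - a2 * a3 * x * r4) / (a4 + r4))) by (field; lra).
  assert (0 < a3 / a2) by (apply Rdiv_lt_0_compat; assumption).
  rewrite Rabs_mult, (Rabs_pos_eq (a3 / a2)) by lra.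
  rewrite Rabs_mult, (Rabs_pos_eq (a3 ^ 2)), Rpow_mult_distr by lra.
  replace (a3 / a2 * ((Rabs K1 + a2 * a3 * (Rabs K4 + 1)) / (a4 / 2)) * / (a3 ^ 2) ^ 3 *
    ((a3 ^ 2) ^ 3 * Rabs x ^ 3)) with
    (a3 / a2 * (((Rabs K1 + a2 * a3 * (Rabs K4 + 1)) * Rabs x ^ 3) / (a4 / 2))) by (field; lra).
  apply Rmult_le_compat_l; [lra|].
  unfold Rdiv at 1 3. rewrite Rabs_mult, Rabs_inv, (Rabs_pos_eq (a4 + r4)) by lra.
  apply Rmult_le_compat; [apply Rabs_pos|apply Rlt_le, Rinv_0_lt_compat; lra| |apply Rinv_le_contravar; lra].
  unfold Rminus. eapply Rle_trans; [apply Rabs_triang|].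
  rewrite Rabs_Ropp, !Rabs_mult, (Rabs_pos_eq a2), (Rabs_pos_eq a3) by lra.
  assert (0 < a2 * a3) by (apply Rmult_lt_0_compat; assumption).
  assert (a2 * a3 * Rabs x * Rabs r4 <= a2 * a3 * Rabs x * ((Rabs K4 + 1) * Rabs x ^ 2))
    by (apply Rmult_le_compat_l; [nra|assumption]).
  simpl in *. nra.
Qed.

(** * Second-order Taylor expansions *)

(** [f u = c0 + c1 u + c2 u^2 + O(u^3)] at 0.  Unlike differentiability it can be checked
    on functions that are only known through bounds. *)
Definition tay2 (f : R -> R) (c0 c1 c2 : R) : Prop :=
  exists K d, 0 < d /\
    forall u, Rabs u < d -> Rabs (f u - (c0 + c1 * u + c2 * u ^ 2)) <= K * Rabs u ^ 3.

Lemma tay2_norm f c0 c1 c2 : tay2 f c0 c1 c2 ->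
  exists K d, 0 < d <= 1 /\ 0 <= K /\
    forall u, Rabs u < d -> Rabs (f u - (c0 + c1 * u + c2 * u ^ 2)) <= K * Rabs u ^ 3.
Proof.
  intros (K & d & Hd & H). exists (Rabs K), (Rmin d 1).
  split; [split; [apply Rmin_pos; lra|apply Rmin_r]|]. split; [apply Rabs_pos|].
  intros u Hu. pose proof (Rmin_l d 1).
  eapply Rle_trans; [apply H; lra|].
  apply Rmult_le_compat_r; [apply pow_le, Rabs_pos|apply Rle_abs].
Qed.

Lemma tay2_ext f g c0 c1 c2 d : 0 < d -> (forall u, Rabs u < d -> f u = g u) ->
  tay2 f c0 c1 c2 -> tay2 g c0 c1 c2.
Proof.
  intros Hd E (K & d' & Hd' & H). exists K, (Rmin d d').
  split; [apply Rmin_pos; assumption|]. intros u Hu.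
  pose proof (Rmin_l d d'). pose proof (Rmin_r d d').
  rewrite <- E by lra. apply H. lra.
Qed.

Lemma tay2_poly c0 c1 c2 : tay2 (fun u => c0 + c1 * u + c2 * u ^ 2) c0 c1 c2.
Proof.
  exists 0, 1. split; [lra|]. intros u _. rewrite Rminus_diag, Rabs_R0.
  lra.
Qed.

Lemma tay2_const c : tay2 (fun _ => c) c 0 0.
Proof. apply (tay2_ext (fun u => c + 0 * u + 0 * u ^ 2) _ _ _ _ 1); [lra|intros; ring|apply tay2_poly]. Qed.

Lemma tay2_lin f g a b c0 c1 c2 d0 d1 d2 : tay2 f c0 c1 c2 -> tay2 g d0 d1 d2 ->
  tay2 (fun u => a * f u + b * g u) (a * c0 + b * d0) (a * c1 + b * d1) (a * c2 + b * d2).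
Proof.
  intros (K & d & Hd & H) (K' & d' & Hd' & H').
  exists (Rabs a * K + Rabs b * K'), (Rmin d d'). split; [apply Rmin_pos; assumption|].
  intros u Hu. pose proof (Rmin_l d d'). pose proof (Rmin_r d d').
  specialize (H u ltac:(lra)). specialize (H' u ltac:(lra)).
  replace (a * f u + b * g u - (a * c0 + b * d0 + (a * c1 + b * d1) * u + (a * c2 + b * d2) * u ^ 2))
    with (a * (f u - (c0 + c1 * u + c2 * u ^ 2)) + b * (g u - (d0 + d1 * u + d2 * u ^ 2))) by ring.
  eapply Rle_trans; [apply Rabs_triang|]. rewrite !Rabs_mult.
  rewrite Rmult_plus_distr_r, !Rmult_assoc.
  apply Rplus_le_compat; apply Rmult_le_compat_l; (apply Rabs_pos || assumption).
Qed.

Lemma poly_bound c0 c1 c2 u : Rabs u <= 1 ->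
  Rabs (c0 + c1 * u + c2 * u ^ 2) <= Rabs c0 + Rabs c1 + Rabs c2.
Proof.
  intros Hu. pose proof (Rabs_pos u).
  eapply Rle_trans; [apply Rabs_triang|]. apply Rplus_le_compat.
  - eapply Rle_trans; [apply Rabs_triang|]. rewrite Rabs_mult.
    pose proof (Rabs_pos c1). nra.
  - rewrite Rabs_mult, <- RPow_abs. pose proof (Rabs_pos c2).
    assert (Rabs u ^ 2 <= 1) by (simpl; nra). nra.
Qed.

Lemma tay2_mult f g c0 c1 c2 d0 d1 d2 : tay2 f c0 c1 c2 -> tay2 g d0 d1 d2 ->
  tay2 (fun u => f u * g u) (c0 * d0) (c0 * d1 + c1 * d0) (c0 * d2 + c1 * d1 + c2 * d0).
Proof.
  intros Hf Hg.
  destruct (tay2_norm _ _ _ _ Hf) as (K & d & Hd & HK & H).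
  destruct (tay2_norm _ _ _ _ Hg) as (K' & d' & Hd' & HK' & H').
  set (P := Rabs c0 + Rabs c1 + Rabs c2). set (P' := Rabs d0 + Rabs d1 + Rabs d2).
  exists (K * (P' + K') + P * K' + (Rabs (c1 * d2 + c2 * d1) + Rabs (c2 * d2))), (Rmin d d').
  split; [apply Rmin_pos; lra|].
  intros u Hu. pose proof (Rmin_l d d'). pose proof (Rmin_r d d').
  specialize (H u ltac:(lra)). specialize (H' u ltac:(lra)).
  pose proof (Rabs_pos u) as Hu0.
  assert (Hu3 : 0 <= Rabs u ^ 3 <= 1).
  { split; [apply pow_le; lra|]. rewrite <- (pow1 3). apply pow_incr. lra. }
  assert (B := poly_bound c0 c1 c2 u ltac:(lra)). fold P in B.
  assert (B' := poly_bound d0 d1 d2 u ltac:(lra)). fold P' in B'.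
  set (p := c0 + c1 * u + c2 * u ^ 2) in *. set (p' := d0 + d1 * u + d2 * u ^ 2) in *.
  set (r := f u - p) in *. set (r' := g u - p') in *.
  replace (f u * g u - (c0 * d0 + (c0 * d1 + c1 * d0) * u + (c0 * d2 + c1 * d1 + c2 * d0) * u ^ 2))
    with (r * (p' + r') + p * r' + (c1 * d2 + c2 * d1 + c2 * d2 * u) * u ^ 3)
    by (unfold r, r', p, p'; ring).
  clearbody p p' r r' P P'.
  rewrite !Rmult_plus_distr_r.
  eapply Rle_trans; [apply Rabs_triang|].
  assert (T1 : Rabs (r * (p' + r') + p * r') <= K * (P' + K') * Rabs u ^ 3 + P * K' * Rabs u ^ 3).
  { eapply Rle_trans; [apply Rabs_triang|]. apply Rplus_le_compat; rewrite Rabs_mult.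
    - replace (K * (P' + K') * Rabs u ^ 3) with (K * Rabs u ^ 3 * (P' + K')) by ring.
      apply Rmult_le_compat; try apply Rabs_pos; [assumption|].
      eapply Rle_trans; [apply Rabs_triang|]. apply Rplus_le_compat; [assumption|]. nra.
    - rewrite (Rmult_assoc P K'). apply Rmult_le_compat; try apply Rabs_pos; assumption. }
  assert (T2 : Rabs ((c1 * d2 + c2 * d1 + c2 * d2 * u) * u ^ 3)
               <= (Rabs (c1 * d2 + c2 * d1) + Rabs (c2 * d2)) * Rabs u ^ 3).
  { rewrite Rabs_mult, <- RPow_abs. apply Rmult_le_compat_r; [lra|].
    eapply Rle_trans; [apply Rabs_triang|]. apply Rplus_le_compat_l.
    rewrite (Rabs_mult (c2 * d2)). pose proof (Rabs_pos (c2 * d2)). nra. }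
  rewrite <- !Rmult_plus_distr_r in *. lra.
Qed.

Lemma tay2_near f c0 c1 c2 e : tay2 f c0 c1 c2 -> 0 < e ->
  exists d, 0 < d /\ forall u, Rabs u < d -> Rabs (f u - c0) < e.
Proof.
  intros Hf He. destruct (tay2_norm _ _ _ _ Hf) as (K & d & Hd & HK & H).
  set (S := Rabs c1 + Rabs c2 + K + 1).
  assert (HS : 0 < S) by (unfold S; pose proof (Rabs_pos c1); pose proof (Rabs_pos c2); lra).
  exists (Rmin d (e / S)).
  split; [apply Rmin_pos; [lra|apply Rdiv_lt_0_compat; lra]|].
  intros u Hu. pose proof (Rmin_l d (e / S)). pose proof (Rmin_r d (e / S)).
  specialize (H u ltac:(lra)). pose proof (Rabs_pos u) as Hu0.
  replace (f u - c0) with ((f u - (c0 + c1 * u + c2 * u ^ 2)) + (c1 * u + c2 * u ^ 2)) by ring.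
  apply Rle_lt_trans with (S * Rabs u).
  - eapply Rle_trans; [apply Rabs_triang|].
    assert (Rabs (c1 * u + c2 * u ^ 2) <= Rabs c1 * Rabs u + Rabs c2 * Rabs u ^ 2).
    { eapply Rle_trans; [apply Rabs_triang|]. rewrite !Rabs_mult, <- RPow_abs. lra. }
    assert (Rabs u ^ 2 <= Rabs u) by (simpl; nra).
    assert (Rabs u ^ 3 <= Rabs u) by (assert (0 <= Rabs u ^ 2 <= 1) by (simpl; nra); simpl in *; nra).
    pose proof (Rabs_pos c2). unfold S. nra.
  - assert (Hlt : Rabs u < e / S) by lra.
    apply (Rmult_lt_compat_l S) in Hlt; [|exact HS].
    replace (S * (e / S)) with e in Hlt by (field; lra). exact Hlt.
Qed.

(** The coefficients are those that make the product with [f] equal to [1 + O(u^3)]. *)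
Lemma tay2_inv f c0 c1 c2 : tay2 f c0 c1 c2 -> c0 <> 0 ->
  tay2 (fun u => / f u) (/ c0) (- c1 / c0 ^ 2) (c1 ^ 2 / c0 ^ 3 - c2 / c0 ^ 2).
Proof.
  intros Hf Hc0.
  assert (Hp : 0 < Rabs c0) by (apply Rabs_pos_lt, Hc0).
  destruct (tay2_near f c0 c1 c2 (Rabs c0 / 2) Hf ltac:(lra)) as (d & Hd & Hnear).
  pose (i0 := / c0). pose (i1 := - c1 / c0 ^ 2). pose (i2 := c1 ^ 2 / c0 ^ 3 - c2 / c0 ^ 2).
  pose proof (tay2_mult _ _ _ _ _ _ _ _ Hf (tay2_poly i0 i1 i2)) as (K & d' & Hd' & H).
  exists (K * / (Rabs c0 / 2)), (Rmin d d'). split; [apply Rmin_pos; assumption|].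
  intros u Hu. pose proof (Rmin_l d d'). pose proof (Rmin_r d d').
  specialize (Hnear u ltac:(lra)). specialize (H u ltac:(lra)).
  fold i0 i1 i2. set (p := i0 + i1 * u + i2 * u ^ 2) in *.
  assert (Hfu : Rabs c0 / 2 <= Rabs (f u)).
  { pose proof (Rabs_triang (f u) (- (f u - c0))) as T.
    replace (f u + - (f u - c0)) with c0 in T by ring. rewrite Rabs_Ropp in T. lra. }
  assert (Hfu0 : f u <> 0) by (intros E; rewrite E, Rabs_R0 in Hfu; lra).
  replace (c0 * i0 + (c0 * i1 + c1 * i0) * u + (c0 * i2 + c1 * i1 + c2 * i0) * u ^ 2)
    with 1 in H by (unfold i0, i1, i2; field; exact Hc0).
  replace (/ f u - p) with (- (f u * p - 1) * / f u) by (field; exact Hfu0).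
  rewrite Rabs_mult, Rabs_Ropp, Rabs_inv.
  replace (K * / (Rabs c0 / 2) * Rabs u ^ 3) with (K * Rabs u ^ 3 * / (Rabs c0 / 2)) by ring.
  apply Rmult_le_compat; [apply Rabs_pos|apply Rlt_le, Rinv_0_lt_compat; lra|exact H|].
  apply Rinv_le_contravar; lra.
Qed.

Lemma tay2_squeeze f g c0 c1 c2 K d : tay2 g c0 c1 c2 -> 0 < d ->
  (forall u, Rabs u < d -> Rabs (f u - g u) <= K * Rabs u ^ 3) -> tay2 f c0 c1 c2.
Proof.
  intros (K' & d' & Hd' & H') Hd H. exists (K + K'), (Rmin d d').
  split; [apply Rmin_pos; assumption|]. intros u Hu.
  pose proof (Rmin_l d d'). pose proof (Rmin_r d d').
  specialize (H u ltac:(lra)). specialize (H' u ltac:(lra)).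
  replace (f u - (c0 + c1 * u + c2 * u ^ 2))
    with ((f u - g u) + (g u - (c0 + c1 * u + c2 * u ^ 2))) by ring.
  eapply Rle_trans; [apply Rabs_triang|]. lra.
Qed.

Lemma small_poly_zero c0 c1 c2 K d : 0 < d ->
  (forall u, 0 < u < d -> Rabs (c0 + c1 * u + c2 * u ^ 2) <= K * u ^ 3) ->
  c0 = 0 /\ c1 = 0 /\ c2 = 0.
Proof.
  intros Hd H.
  assert (Z : forall (c : R) (C d' : R), 0 < d' -> (forall u, 0 < u < d' -> Rabs c <= C * u) -> c = 0).
  { intros c C d' Hd' HC. destruct (Req_dec c 0) as [E|E]; [exact E|exfalso].
    apply Rabs_pos_lt in E.
    set (D := Rabs C + 1). assert (HD : 0 < D) by (unfold D; pose proof (Rabs_pos C); lra).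
    set (u := Rmin d' (Rabs c / D) / 2).
    assert (Hq : 0 < Rabs c / D) by (apply Rdiv_lt_0_compat; assumption).
    pose proof (Rmin_l d' (Rabs c / D)). pose proof (Rmin_r d' (Rabs c / D)).
    assert (Hm : 0 < Rmin d' (Rabs c / D)) by (apply Rmin_pos; assumption).
    specialize (HC u ltac:(unfold u; lra)).
    assert (C * u <= D * u).
    { apply Rmult_le_compat_r; [unfold u; lra|]. unfold D. pose proof (Rle_abs C). lra. }
    assert (D * u < D * (Rabs c / D)) by (apply Rmult_lt_compat_l; [exact HD|unfold u; lra]).
    replace (D * (Rabs c / D)) with (Rabs c) in * by (field; lra). lra. }
  set (e := Rmin d 1).
  pose proof (Rmin_l d 1). pose proof (Rmin_r d 1).
  assert (He : 0 < e) by (apply Rmin_pos; lra). fold e in H0, H1.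
  assert (HK : forall u, 0 < u < e -> K * u ^ 3 <= Rabs K * u ^ 3).
  { intros u Hu. apply Rmult_le_compat_r; [apply pow_le; lra|apply Rle_abs]. }
  assert (E0 : c0 = 0).
  { apply (Z c0 (Rabs K + Rabs c1 + Rabs c2) e He). intros u Hu.
    specialize (H u ltac:(lra)). specialize (HK u Hu).
    replace c0 with ((c0 + c1 * u + c2 * u ^ 2) + - (c1 * u + c2 * u ^ 2)) at 1 by ring.
    eapply Rle_trans; [apply Rabs_triang|]. rewrite Rabs_Ropp.
    assert (Rabs (c1 * u + c2 * u ^ 2) <= Rabs c1 * u + Rabs c2 * u ^ 2).
    { eapply Rle_trans; [apply Rabs_triang|]. rewrite !Rabs_mult.
      rewrite (Rabs_pos_eq u), (Rabs_pos_eq (u ^ 2)) by (try apply pow_le; lra). lra. }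
    assert (u ^ 2 <= u) by (simpl; nra). assert (u ^ 3 <= u) by (simpl in *; nra).
    pose proof (Rabs_pos c2). pose proof (Rabs_pos K). nra. }
  subst c0.
  assert (E1 : c1 = 0).
  { apply (Z c1 (Rabs K + Rabs c2) e He). intros u Hu.
    specialize (H u ltac:(lra)). specialize (HK u Hu).
    replace (0 + c1 * u + c2 * u ^ 2) with (u * (c1 + c2 * u)) in H by ring.
    rewrite Rabs_mult, (Rabs_pos_eq u) in H by lra.
    assert (H2 : Rabs (c1 + c2 * u) <= Rabs K * u ^ 2).
    { apply (Rmult_le_reg_l u); [lra|].
      replace (u * (Rabs K * u ^ 2)) with (Rabs K * u ^ 3) by ring. lra. }
    replace c1 with ((c1 + c2 * u) + - (c2 * u)) at 1 by ring.
    eapply Rle_trans; [apply Rabs_triang|]. rewrite Rabs_Ropp, (Rabs_mult c2), (Rabs_pos_eq u) by lra.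
    assert (u ^ 2 <= u) by (simpl; nra). pose proof (Rabs_pos K). nra. }
  subst c1. split; [reflexivity|]. split; [reflexivity|].
  apply (Z c2 (Rabs K) e He). intros u Hu.
  specialize (H u ltac:(lra)). specialize (HK u Hu).
  replace (0 + 0 * u + c2 * u ^ 2) with (u ^ 2 * c2) in H by ring.
  assert (Hu2 : 0 < u ^ 2) by (apply pow_lt; lra).
  rewrite Rabs_mult, (Rabs_pos_eq (u ^ 2)) in H by lra.
  apply (Rmult_le_reg_l (u ^ 2)); [exact Hu2|].
  replace (u ^ 2 * (Rabs K * u)) with (Rabs K * u ^ 3) by ring. lra.
Qed.

Lemma tay2_unique f c0 c1 c2 d0 d1 d2 : tay2 f c0 c1 c2 -> tay2 f d0 d1 d2 ->
  c0 = d0 /\ c1 = d1 /\ c2 = d2.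
Proof.
  intros Hf Hg.
  destruct (tay2_lin _ _ (-1) 1 _ _ _ _ _ _ Hf Hg) as (K & d & Hd & H).
  destruct (small_poly_zero (-1 * c0 + 1 * d0) (-1 * c1 + 1 * d1) (-1 * c2 + 1 * d2) K d Hd)
    as (E0 & E1 & E2).
  - intros u Hu. specialize (H u ltac:(rewrite Rabs_pos_eq; lra)).
    replace (-1 * f u + 1 * f u) with 0 in H by ring.
    rewrite Rminus_0_l, Rabs_Ropp, (Rabs_pos_eq u) in H by lra. exact H.
  - repeat split; lra.
Qed.

(** * Bounds for g-fractions at real points *)

Fixpoint rtail (g : nat -> R) (w : R) (n j : nat) : R :=
  match n with
  | O => 1
  | S m => 1 + gnum g (S j) * w / rtail g w m (S j)
  end.

Lemma gfrac_tail_RtoC g w n j : gfrac_tail g (RtoC w) n j = RtoC (rtail g w n j).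
Proof.
  revert j; induction n as [|n IH]; intros j; [reflexivity|].
  simpl gfrac_tail. rewrite IH, <- RtoC_mult, Cdiv_RtoC, <- RtoC_plus. reflexivity.
Qed.

(** Induction from the innermost term: the next tail [t] satisfies
    [t >= 1 + (1 - g) w >= g] when [w <= 0] and [t >= 1] when [w >= 0], with [g] the
    coefficient in front of it; hence [0 <= g / t <= 1]. *)
Lemma rtail_bounds g w n j :
  (forall i, (1 <= i)%nat -> 0 <= g i <= 1) -> -1 < w -> (1 <= j)%nat ->
  (0 <= w -> 1 <= rtail g w n j <= 1 + (1 - g j) * w) /\
  (w <= 0 -> 1 + (1 - g j) * w <= rtail g w n j <= 1).
Proof.
  intros Hg Hw. revert j; induction n as [|n IH]; intros j Hj.
  - simpl. pose proof (Hg j Hj). split; intros; nra.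
  - simpl rtail. destruct j as [|j]; [lia|].
    change (gnum g (S (S j))) with ((1 - g (S j)) * g (S (S j))).
    destruct (IH (S (S j)) ltac:(lia)) as [H1 H2].
    pose proof (Hg (S j) Hj) as Hg1. pose proof (Hg (S (S j)) ltac:(lia)) as Hg2.
    set (t := rtail g w n (S (S j))) in *. clearbody t.
    set (x := g (S j)) in *. set (y := g (S (S j))) in *. clearbody x y.
    assert (Ht : 0 < t) by (destruct (Rle_dec 0 w); nra).
    assert (Hyt : 0 <= y / t <= 1).
    { split.
      - apply Rmult_le_pos; [lra|]. apply Rlt_le, Rinv_0_lt_compat, Ht.
      - apply (Rmult_le_reg_r t); [exact Ht|].
        unfold Rdiv. rewrite Rmult_assoc, Rinv_l by lra.
        destruct (Rle_dec 0 w); nra. }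
    replace ((1 - x) * y * w / t) with ((1 - x) * (y / t) * w) by (field; lra).
    assert (0 <= (1 - x) * (y / t) <= 1 - x) by nra.
    split; intros; nra.
Qed.

Lemma one_plus_pos c w : 0 <= c <= 1 -> -1 < w -> 0 < 1 + c * w.
Proof.
  intros Hc Hw. destruct (Rle_dec 0 w) as [H|H]; [nra|].
  assert (0 <= (1 - c) * - w) by (apply Rmult_le_pos; lra). nra.
Qed.

(** The fraction [1 / (1 + g_1 w / (1 + (1 - g_1) g_2 w / t))] with its denominators
    cleared; [t] stands for the unknown tail. *)
Definition gfrac_env (g1 g2 w t : R) : R :=
  (t + (1 - g1) * g2 * w) / (t * (1 + g1 * w) + (1 - g1) * g2 * w).

(** At the tail [t = 1 + (1 - g_2) w] the last denominator factors as
    [(1 + w) (1 + g_1 (1 - g_2) w)]. *)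
Lemma gfrac_env_denominators g1 g2 w t : 0 <= g1 <= 1 -> 0 <= g2 <= 1 -> -1 < w ->
  Rmin 1 (1 + (1 - g2) * w) <= t ->
  0 < t /\ 0 < t + (1 - g1) * g2 * w /\ 0 < t * (1 + g1 * w) + (1 - g1) * g2 * w.
Proof.
  intros H1 H2 Hw Ht.
  assert (0 <= g1 * g2 <= 1) by nra.
  assert (0 <= (1 - g1) * g2 <= 1) by nra.
  assert (0 <= g1 * (1 - g2) <= 1) by nra.
  assert (Hg1 : 0 < 1 + g1 * w) by (apply one_plus_pos; assumption).
  destruct (Rle_dec 0 w) as [Hw0|Hw0].
  - rewrite Rmin_left in Ht by nra.
    assert (0 <= (1 - g1) * g2 * w) by (apply Rmult_le_pos; lra).
    assert (0 < t * (1 + g1 * w)) by (apply Rmult_lt_0_compat; lra).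
    repeat split; lra.
  - rewrite Rmin_right in Ht by nra.
    assert (E1 : 0 < (1 + (1 - g2) * w) + (1 - g1) * g2 * w).
    { replace ((1 + (1 - g2) * w) + (1 - g1) * g2 * w) with (1 + (1 - g1 * g2) * w) by ring.
      apply one_plus_pos; lra. }
    assert (E2 : 0 < (1 + (1 - g2) * w) * (1 + g1 * w) + (1 - g1) * g2 * w).
    { replace ((1 + (1 - g2) * w) * (1 + g1 * w) + (1 - g1) * g2 * w)
        with ((1 + w) * (1 + g1 * (1 - g2) * w)) by ring.
      apply Rmult_lt_0_compat; [lra|]. apply one_plus_pos; assumption. }
    assert (0 < 1 + (1 - g2) * w) by (apply one_plus_pos; lra).
    assert ((1 + (1 - g2) * w) * (1 + g1 * w) <= t * (1 + g1 * w))
      by (apply Rmult_le_compat_r; lra).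
    repeat split; lra.
Qed.

(** The difference of the values at [t] and [s] has numerator
    [(1 - g_1) g_2 g_1 w^2 (s - t)]. *)
Lemma gfrac_env_antitone g1 g2 w s t : 0 <= g1 <= 1 -> 0 <= g2 <= 1 -> -1 < w ->
  Rmin 1 (1 + (1 - g2) * w) <= s -> s <= t ->
  gfrac_env g1 g2 w t <= gfrac_env g1 g2 w s.
Proof.
  intros H1 H2 Hw Hs Hst.
  destruct (gfrac_env_denominators g1 g2 w s H1 H2 Hw Hs) as (_ & _ & Ds).
  destruct (gfrac_env_denominators g1 g2 w t H1 H2 Hw ltac:(lra)) as (_ & _ & Dt).
  unfold gfrac_env. set (a := (1 - g1) * g2) in *.
  assert (0 <= a) by (unfold a; nra). clearbody a.
  apply Rminus_le.
  match goal with |- ?n1 / ?d1 - ?n2 / ?d2 <= 0 =>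
    replace (n1 / d1 - n2 / d2) with (a * g1 * Rsqr w * (s - t) / (d1 * d2))
      by (unfold Rsqr; field; lra);
    assert (0 < / (d1 * d2)) by (apply Rinv_0_lt_compat, Rmult_lt_0_compat; assumption)
  end.
  unfold Rdiv.
  assert (0 <= a * g1 * Rsqr w) by (pose proof (Rle_0_sqr w); apply Rmult_le_pos; [nra|assumption]).
  assert (0 <= a * g1 * Rsqr w * (t - s)) by (apply Rmult_le_pos; lra).
  nra.
Qed.

Lemma gfrac_approximant_env g w n :
  (forall i, (1 <= i)%nat -> 0 <= g i <= 1) -> -1 < w ->
  gfrac_approximant g (RtoC w) (S (S n)) = RtoC (gfrac_env (g 1%nat) (g 2%nat) w (rtail g w n 2)).
Proof.
  intros Hg Hw. unfold gfrac_approximant. rewrite gfrac_tail_RtoC, Cdiv_RtoC. f_equal.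
  change (rtail g w (S (S n)) 0)
    with (1 + g 1%nat * w / (1 + (1 - g 1%nat) * g 2%nat * w / rtail g w n 2)).
  destruct (rtail_bounds g w n 2 Hg Hw ltac:(lia)) as [B1 B2].
  destruct (gfrac_env_denominators (g 1%nat) (g 2%nat) w (rtail g w n 2)) as (D1 & D2 & D3); auto.
  { destruct (Rle_dec 0 w); [rewrite Rmin_left|rewrite Rmin_right];
      pose proof (Hg 2%nat ltac:(lia)); (lra || nra). }
  unfold gfrac_env. field. repeat split; try lra.
Qed.

Lemma lim_ge (e : nat -> R) (l c : R) : is_lim_seq e l -> (forall n, c <= e n) -> c <= l.
Proof.
  intros H Hc. apply (is_lim_seq_le (fun _ => c) e c l Hc); [apply is_lim_seq_const|exact H].
Qed.

Lemma lim_le (e : nat -> R) (l c : R) : is_lim_seq e l -> (forall n, e n <= c) -> l <= c.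
Proof.
  intros H Hc. apply (is_lim_seq_le e (fun _ => c) l c Hc); [exact H|apply is_lim_seq_const].
Qed.

(** Every approximant of order at least 2 is a value of [gfrac_env] at a tail between 1 and
    [1 + (1 - g_2) w]; the bounds pass to the limit. *)
Lemma gfrac_bounds g w v :
  (forall i, (1 <= i)%nat -> 0 <= g i <= 1) -> -1 < w -> is_gfrac g (RtoC w) v ->
  v = RtoC (Re v) /\
  (0 <= w -> gfrac_env (g 1%nat) (g 2%nat) w (1 + (1 - g 2%nat) * w) <= Re v
             <= gfrac_env (g 1%nat) (g 2%nat) w 1) /\
  (w <= 0 -> gfrac_env (g 1%nat) (g 2%nat) w 1 <= Re v
             <= gfrac_env (g 1%nat) (g 2%nat) w (1 + (1 - g 2%nat) * w)).
Proof.
  intros Hg Hw Hv.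
  set (e := fun n => gfrac_env (g 1%nat) (g 2%nat) w (rtail g w n 2)).
  assert (Hl : forall n, gfrac_approximant g (RtoC w) (n + 2) = RtoC (e n)).
  { intros n. replace (n + 2)%nat with (S (S n)) by lia. apply gfrac_approximant_env; assumption. }
  assert (Hre : is_lim_seq e (Re v)).
  { intros P HP. destruct HP as [eps HP].
    destruct (Hv (ball v eps)) as [N HN]; [exists eps; auto|].
    exists N. intros n Hn. apply HP. specialize (HN (n + 2)%nat ltac:(lia)).
    rewrite Hl in HN. exact (proj1 HN). }
  assert (Him : is_lim_seq (fun _ => 0) (Im v)).
  { intros P HP. destruct HP as [eps HP].
    destruct (Hv (ball v eps)) as [N HN]; [exists eps; auto|].
    exists N. intros n Hn. apply HP. specialize (HN (n + 2)%nat ltac:(lia)).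
    rewrite Hl in HN. exact (proj2 HN). }
  split.
  { apply is_lim_seq_unique in Him. rewrite Lim_seq_const in Him. injection Him as E.
    destruct v as [v1 v2]. unfold RtoC. simpl in *. subst. reflexivity. }
  pose proof (Hg 1%nat ltac:(lia)) as H1. pose proof (Hg 2%nat ltac:(lia)) as H2.
  assert (Hb := fun n => rtail_bounds g w n 2 Hg Hw ltac:(lia)).
  split; intros Hw0; split.
  - apply (lim_ge e _ _ Hre). intros n. destruct (Hb n) as [Hb1 _]. specialize (Hb1 Hw0).
    apply gfrac_env_antitone; try assumption; [rewrite Rmin_left by nra|]; lra.
  - apply (lim_le e _ _ Hre). intros n. destruct (Hb n) as [Hb1 _]. specialize (Hb1 Hw0).
    apply gfrac_env_antitone; try assumption; [rewrite Rmin_left by nra|]; lra.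
  - apply (lim_ge e _ _ Hre). intros n. destruct (Hb n) as [_ Hb1]. specialize (Hb1 Hw0).
    apply gfrac_env_antitone; try assumption; [rewrite Rmin_right by nra|]; lra.
  - apply (lim_le e _ _ Hre). intros n. destruct (Hb n) as [_ Hb1]. specialize (Hb1 Hw0).
    apply gfrac_env_antitone; try assumption; [rewrite Rmin_right by nra|]; lra.
Qed.

Lemma Csqrt_RtoC y : 0 <= y -> Csqrt (RtoC y) = RtoC (sqrt y).
Proof.
  intros Hy. unfold Csqrt. rewrite Cmod_R, Rabs_pos_eq by exact Hy. simpl.
  replace ((y - y) / 2) with 0 by field. replace ((y + y) / 2) with y by field.
  rewrite sqrt_0, Rmult_0_r. reflexivity.
Qed.

(** The restriction of [Phi] to the real axis. *)
Definition rPhi (T B x : R) : R :=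
  let s := rsn (nome T B) (ellK (nome T B) / T * x) in 2 * s / (1 - s).

Lemma nome_bounds T B : 0 < T -> 0 < B -> 0 < nome T B < 1.
Proof.
  intros HT HB. unfold nome. split; [apply exp_pos|].
  rewrite <- exp_0. apply exp_increasing.
  assert (0 < PI * B / T).
  { apply Rdiv_lt_0_compat; [|exact HT]. apply Rmult_lt_0_compat; [apply PI_RGT_0|exact HB]. }
  lra.
Qed.

Lemma Phi_RtoC T B x : 0 < T -> 0 < B -> Phi T B (RtoC x) = RtoC (rPhi T B x).
Proof.
  intros HT HB. unfold Phi, rPhi.
  rewrite <- RtoC_mult, jacobi_sn_RtoC by (apply nome_bounds; assumption).
  rewrite <- RtoC_mult, <- RtoC_minus, Cdiv_RtoC. reflexivity.
Qed.

Lemma rect_RtoC T B x : 0 < B -> -T < x < T -> rect T B (RtoC x).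
Proof.
  intros HB Hx. split; simpl.
  - apply Rabs_def1; lra.
  - rewrite Rabs_R0. exact HB.
Qed.

Lemma representation_real M T B mu g f x : 0 < T -> 0 < B ->
  gfrac_representation M T B mu g f -> -T < x < T -> -1 < rPhi T B x ->
  let w := rPhi T B x in
  exists v, 0 < v /\ Re (f (RtoC x)) = M * (1 - 2 / (mu * (sqrt (1 + w) * v) + 1)) /\
  (0 <= w -> gfrac_env (g 1%nat) (g 2%nat) w (1 + (1 - g 2%nat) * w) <= v
             <= gfrac_env (g 1%nat) (g 2%nat) w 1) /\
  (w <= 0 -> gfrac_env (g 1%nat) (g 2%nat) w 1 <= v
             <= gfrac_env (g 1%nat) (g 2%nat) w (1 + (1 - g 2%nat) * w)).
Proof.
  intros HT HB (Hmu & Hg & Hrep) Hx Hw w.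
  destruct (Hrep (RtoC x) (rect_RtoC T B x HB Hx)) as (v & Hv & Hf).
  rewrite Phi_RtoC in Hv, Hf by assumption. fold w in Hv, Hf, Hw.
  destruct (gfrac_bounds g w v Hg Hw Hv) as (Ev & Hb).
  exists (Re v). split; [|split; [|exact Hb]].
  { pose proof (Hg 1%nat ltac:(lia)) as H1. pose proof (Hg 2%nat ltac:(lia)) as H2.
    assert (Hpos : forall t, Rmin 1 (1 + (1 - g 2%nat) * w) <= t ->
              0 < gfrac_env (g 1%nat) (g 2%nat) w t).
    { intros t Ht. destruct (gfrac_env_denominators _ _ w t H1 H2 Hw Ht) as (_ & D1 & D2).
      apply Rdiv_lt_0_compat; assumption. }
    pose proof (Hpos _ (Rmin_l _ _)). pose proof (Hpos _ (Rmin_r _ _)).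
    destruct Hb as [Hb1 Hb2].
    destruct (Rle_dec 0 w) as [Hw0|Hw0]; [specialize (Hb1 Hw0)|specialize (Hb2 ltac:(lra))]; lra. }
  rewrite Hf, Ev at 1.
  rewrite <- RtoC_plus, Csqrt_RtoC by lra.
  rewrite <- !RtoC_mult, <- RtoC_plus, Cdiv_RtoC, <- RtoC_minus, <- RtoC_mult.
  simpl. rewrite Rmult_assoc. reflexivity.
Qed.

(** * Where the envelopes recross 1 *)

(** The point is the vertex of the quadratic, where its value is
    [- u^2 / (4 ((1 - u) v)^2)] times the quantity assumed nonnegative.  The vertex exceeds [-1] when
    [u^2 > 2 (1 - u)^2 v (1 - v)], which is weaker than the hypothesis, and it differs
    from 0 because the quadratic is positive at 0. *)
Lemma quadratic_nonpos_at_vertex u v : 0 < u < 1 / 2 -> 0 < v < 1 ->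
  0 <= u ^ 2 - 4 * (1 - u) ^ 2 * (1 - v) * v ->
  exists w, -1 < w /\ w <> 0 /\
    (1 - 2 * u) + (2 * (1 - u) ^ 2 * v - u ^ 2) * w + ((1 - u) * v) ^ 2 * w ^ 2 <= 0.
Proof.
  intros Hu Hv HA.
  set (a := (1 - u) * v).
  assert (Ha : 0 < a) by (unfold a; nra).
  (* The minimum of the quadratic, whose leading coefficient is [a^2]. *)
  set (w := (u ^ 2 - 2 * (1 - u) ^ 2 * v) / (2 * a ^ 2)).
  assert (Ha2 : 0 < a ^ 2) by (apply pow_lt; exact Ha).
  assert (Ew : 2 * a ^ 2 * w = u ^ 2 - 2 * (1 - u) ^ 2 * v) by (unfold w; field; lra).
  assert (Q : (1 - 2 * u) + (2 * (1 - u) ^ 2 * v - u ^ 2) * w + a ^ 2 * w ^ 2 <= 0).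
  { replace ((1 - 2 * u) + (2 * (1 - u) ^ 2 * v - u ^ 2) * w + a ^ 2 * w ^ 2)
      with (- (u ^ 2 * (u ^ 2 - 4 * (1 - u) ^ 2 * (1 - v) * v)) / (4 * a ^ 2)).
    2:{ unfold w, a. field. lra. }
    assert (0 < / (4 * a ^ 2)) by (apply Rinv_0_lt_compat; lra).
    assert (0 <= u ^ 2 * (u ^ 2 - 4 * (1 - u) ^ 2 * (1 - v) * v))
      by (apply Rmult_le_pos; [apply pow2_ge_0|exact HA]).
    unfold Rdiv. nra. }
  exists w. split; [|split; [|exact Q]].
  - apply (Rmult_lt_reg_l (2 * a ^ 2)); [lra|]. rewrite Ew.
    assert (0 < (1 - u) ^ 2 * ((1 - v) * v)).
    { apply Rmult_lt_0_compat; [apply pow_lt; lra|]. apply Rmult_lt_0_compat; lra. }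
    replace (a ^ 2) with ((1 - u) ^ 2 * v ^ 2) by (unfold a; ring).
    nra.
  - intros E. rewrite E in Q. simpl in Q. lra.
Qed.

Lemma sqrt_ratio_le_1 y n d : 0 <= y -> 0 <= n -> 0 < d ->
  y * n ^ 2 <= d ^ 2 -> sqrt y * (n / d) <= 1.
Proof.
  intros Hy Hn Hd H.
  apply (Rmult_le_reg_r d); [exact Hd|].
  replace (sqrt y * (n / d) * d) with (sqrt y * n) by (field; lra).
  rewrite Rmult_1_l. apply Rsqr_incr_0_var; [|lra].
  unfold Rsqr. pose proof (sqrt_sqrt y Hy). nra.
Qed.

Lemma sqrt_ratio_ge_1 y n d : 0 <= y -> 0 <= n -> 0 < d ->
  d ^ 2 <= y * n ^ 2 -> 1 <= sqrt y * (n / d).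
Proof.
  intros Hy Hn Hd H.
  apply (Rmult_le_reg_r d); [exact Hd|].
  replace (sqrt y * (n / d) * d) with (sqrt y * n) by (field; lra).
  rewrite Rmult_1_l. pose proof (sqrt_pos y).
  apply Rsqr_incr_0_var; [|apply Rmult_le_pos; lra].
  unfold Rsqr. pose proof (sqrt_sqrt y Hy). nra.
Qed.

(** [(1 + w) n^2 - d^2 = w Q(w)] for the numerator [n] and the denominator [d] of the bound,
    with [Q] the quadratic of the preceding lemma. *)
Lemma env_crossing_lt_half g1 g2 : 0 < g1 < 1 / 2 -> 0 < g2 < 1 ->
  0 <= g1 ^ 2 - 4 * (1 - g1) ^ 2 * (1 - g2) * g2 ->
  exists w, -1 < w /\ w <> 0 /\
    (0 < w -> sqrt (1 + w) * gfrac_env g1 g2 w 1 <= 1) /\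
    (w < 0 -> 1 <= sqrt (1 + w) * gfrac_env g1 g2 w 1).
Proof.
  intros H1 H2 HA. destruct (quadratic_nonpos_at_vertex g1 g2 H1 H2 HA) as (w & Hw & Hw0 & Q).
  exists w. split; [exact Hw|]. split; [exact Hw0|].
  destruct (gfrac_env_denominators g1 g2 w 1) as (_ & D1 & D2); try lra.
  { apply Rmin_l. }
  set (q := (1 - 2 * g1) + (2 * (1 - g1) ^ 2 * g2 - g1 ^ 2) * w + ((1 - g1) * g2) ^ 2 * w ^ 2) in *.
  assert (E : (1 + w) * (1 + (1 - g1) * g2 * w) ^ 2
              - (1 * (1 + g1 * w) + (1 - g1) * g2 * w) ^ 2 = w * q) by (unfold q; ring).
  unfold gfrac_env. split; intros Hs.
  - apply sqrt_ratio_le_1; try lra. nra.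
  - apply sqrt_ratio_ge_1; try lra. nra.
Qed.

(** The difference of squares is now [- w (1 + w)] times the same quadratic, taken at
    [(1 - g_1, 1 - g_2)]. *)
Lemma env_crossing_gt_half g1 g2 : 1 / 2 < g1 < 1 -> 0 < g2 < 1 ->
  0 <= (1 - g1) ^ 2 - 4 * g1 ^ 2 * g2 * (1 - g2) ->
  exists w, -1 < w /\ w <> 0 /\
    (0 < w -> 1 <= sqrt (1 + w) * gfrac_env g1 g2 w (1 + (1 - g2) * w)) /\
    (w < 0 -> sqrt (1 + w) * gfrac_env g1 g2 w (1 + (1 - g2) * w) <= 1).
Proof.
  intros H1 H2 HA.
  destruct (quadratic_nonpos_at_vertex (1 - g1) (1 - g2)) as (w & Hw & Hw0 & Q); try lra.
  exists w. split; [exact Hw|]. split; [exact Hw0|].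
  destruct (gfrac_env_denominators g1 g2 w (1 + (1 - g2) * w)) as (_ & D1 & D2); try lra.
  { apply Rmin_r. }
  match type of Q with ?e <= 0 => set (q := e) in * end.
  assert (E : (1 + w) * (1 + (1 - g2) * w + (1 - g1) * g2 * w) ^ 2
              - ((1 + (1 - g2) * w) * (1 + g1 * w) + (1 - g1) * g2 * w) ^ 2
              = (1 + w) * (- w * q)) by (unfold q; ring).
  unfold gfrac_env. split; intros Hs.
  - apply sqrt_ratio_ge_1; try lra.
    assert (0 <= (1 + w) * (- w * q)) by (apply Rmult_le_pos; nra). lra.
  - apply sqrt_ratio_le_1; try lra.
    assert (0 <= (1 + w) * (w * q)) by (apply Rmult_le_pos; nra). lra.
Qed.

(** * Returning to the initial value *)

(** Just to the right of 0 the function exceeds [F 0], at [x] it does not. *)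
Lemma return_right_incr F T x l : 0 < x < T -> (forall y, -T < y < T -> continuity_pt F y) ->
  is_derive F 0 l -> 0 < l -> F x <= F 0 ->
  exists tau, - T < tau < T /\ tau <> 0 /\ F tau = F 0.
Proof.
  intros Hx HF HD Hl Hle.
  destruct Hle as [Hlt|Heq]; [|exists x; repeat split; lra].
  apply is_derive_Reals in HD.
  destruct (HD (l / 2) ltac:(lra)) as [d Hd].
  set (h := Rmin d x / 2).
  assert (Hm : 0 < Rmin d x) by (apply Rmin_pos; [apply cond_pos|lra]).
  pose proof (Rmin_l d x). pose proof (Rmin_r d x).
  assert (Hh : 0 < h < x) by (unfold h; lra).
  specialize (Hd h ltac:(lra) ltac:(rewrite Rabs_pos_eq; unfold h in *; lra)).
  rewrite Rplus_0_l in Hd. apply Rabs_def2 in Hd.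
  assert (Hinc : 0 < F h - F 0).
  { replace (F h - F 0) with ((F h - F 0) / h * h) by (field; lra).
    apply Rmult_lt_0_compat; lra. }
  destruct (IVT_interv (fun y => F 0 - F y) h x) as (z & Hz & Ez); try lra.
  - intros y Hy. apply (continuity_pt_minus (fun _ => F 0) F).
    + apply continuity_pt_const. intros ? ?; reflexivity.
    + apply HF; lra.
  - exists z. repeat split; lra.
Qed.

Lemma is_derive_reflect F l : is_derive F 0 l -> is_derive (fun y => F (- y)) 0 (- l).
Proof.
  intros H. replace (- l) with (scal (-1) l) by (change (-1 * l = - l); ring).
  apply (is_derive_comp F Ropp 0 l (-1)).
  - rewrite Ropp_0. exact H.
  - auto_derive; [trivial|ring].
Qed.

Lemma return_incr F T x l : - T < x < T -> x <> 0 ->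
  (forall y, -T < y < T -> continuity_pt F y) ->
  is_derive F 0 l -> 0 < l ->
  (0 < x -> F x <= F 0) -> (x < 0 -> F 0 <= F x) ->
  exists tau, - T < tau < T /\ tau <> 0 /\ F tau = F 0.
Proof.
  intros Hx Hx0 HF HD Hl H1 H2.
  destruct (Rtotal_order x 0) as [Hn|[E|Hp]]; [|contradiction|].
  - destruct (return_right_incr (fun y => - F (- y)) T (- x) l) as (tau & Ht & Ht0 & Et).
    + lra.
    + intros y Hy. apply (continuity_pt_opp (fun y => F (- y))).
      apply (continuity_pt_comp Ropp F).
      * apply (continuity_pt_opp (fun y => y)). apply derivable_continuous_pt, derivable_pt_id.
      * apply HF. lra.
    + replace l with (opp (- l)) by (change (- - l = l); ring).
      apply (is_derive_opp (fun y => F (- y))). apply is_derive_reflect, HD.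
    + exact Hl.
    + rewrite Ropp_involutive, Ropp_0. specialize (H2 Hn). lra.
    + exists (- tau). rewrite Ropp_0 in Et. repeat split; lra.
  - apply (return_right_incr F T x l); auto. lra.
Qed.

Lemma return_decr F T x l : - T < x < T -> x <> 0 ->
  (forall y, -T < y < T -> continuity_pt F y) ->
  is_derive F 0 l -> l < 0 ->
  (0 < x -> F 0 <= F x) -> (x < 0 -> F x <= F 0) ->
  exists tau, - T < tau < T /\ tau <> 0 /\ F tau = F 0.
Proof.
  intros Hx Hx0 HF HD Hl H1 H2.
  destruct (return_incr (fun y => - F y) T x (- l)) as (tau & Ht & Ht0 & Et); auto; try lra.
  - intros y Hy. apply (continuity_pt_opp F), HF, Hy.
  - apply (is_derive_opp F 0 l), HD.
  - exists tau. repeat split; lra.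
Qed.

(** * Analytic functions on the real axis *)

Lemma pow_n_RtoC y k : pow_n (RtoC y : C_Ring) k = RtoC (y ^ k).
Proof.
  induction k as [|k IH]; [reflexivity|].
  simpl. rewrite IH. symmetry. apply RtoC_mult.
Qed.

Lemma is_pseries_Re (a : nat -> C) y (l : C) :
  @is_pseries C_AbsRing C_NormedModule a (RtoC y) l ->
  is_pseries (fun n => Re (a n)) y (Re l).
Proof.
  intros H.
  assert (E : forall n,
    Re (@sum_n C_NormedModule (fun k => scal (pow_n (RtoC y : C_AbsRing) k) (a k)) n)
    = sum_n (fun k => scal (pow_n y k) (Re (a k))) n).
  { assert (Hk : forall k, Re (@scal C_AbsRing C_NormedModule (pow_n (RtoC y : C_AbsRing) k) (a k))
                          = scal (pow_n y k) (Re (a k))).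
    { intros k.
      change (Re (pow_n (RtoC y : C_Ring) k * a k)%C = scal (pow_n y k) (Re (a k))).
      rewrite (pow_n_RtoC y k).
      replace (pow_n y k) with (y ^ k) by (symmetry; apply pow_n_pow).
      change (y ^ k * fst (a k) - 0 * snd (a k) = y ^ k * fst (a k)). ring. }
    induction n as [|n IH].
    - rewrite (sum_O (fun k => scal (pow_n y k) (Re (a k)))), <- Hk.
      apply (f_equal Re), (@sum_O C_NormedModule).
    - rewrite (sum_Sn (fun k => scal (pow_n y k) (Re (a k)))), <- IH, <- Hk.
      rewrite (@sum_Sn C_NormedModule). reflexivity. }
  intros P [eps HP].
  destruct (H (ball l eps)) as [N HN]; [exists eps; auto|].
  exists N. intros n Hn. apply HP. specialize (HN n Hn).
  rewrite <- E. exact (proj1 HN).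
Qed.

Lemma CV_radius_ge (b : nat -> R) r y :
  (forall x, Rabs x < r -> ex_pseries b x) -> Rabs y < r -> Rbar_lt (Rabs y) (CV_radius b).
Proof.
  intros H Hy. set (x := (Rabs y + r) / 2).
  pose proof (Rabs_pos y).
  assert (Hx : Rabs x = x) by (apply Rabs_pos_eq; unfold x; lra).
  apply Rbar_lt_le_trans with (Rabs x).
  { rewrite Hx. simpl. unfold x. lra. }
  apply Rbar_not_lt_le. intros Hlt. apply (CV_disk_outside b x Hlt).
  apply ex_series_lim_0. apply ex_pseries_R, H. rewrite Hx. unfold x. lra.
Qed.

Lemma analytic_at_real f x0 : analytic_at f (RtoC x0) ->
  exists (b : nat -> R) r, 0 < r /\
    (forall y, Rabs y < r -> Rbar_lt (Rabs y) (CV_radius b)) /\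
    (forall x, Rabs (x - x0) < r -> Re (f (RtoC x)) = PSeries b (x - x0)).
Proof.
  intros (a & r & Hr & H).
  assert (Hp : forall y, Rabs y < r -> is_pseries (fun n => Re (a n)) y (Re (f (RtoC (x0 + y))))).
  { intros y Hy. apply is_pseries_Re.
    replace (RtoC y) with (RtoC (x0 + y) - RtoC x0)%C
      by (rewrite <- RtoC_minus; f_equal; ring).
    apply H. rewrite <- RtoC_minus, Cmod_R. replace (x0 + y - x0) with y by ring. exact Hy. }
  exists (fun n => Re (a n)), r. split; [exact Hr|]. split.
  - intros y Hy. apply (CV_radius_ge _ r); [|exact Hy].
    intros x Hx. eexists. apply Hp, Hx.
  - intros x Hx. symmetry. apply is_pseries_unique.
    replace x with (x0 + (x - x0)) at 2 by ring. apply Hp, Hx.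
Qed.

Lemma analytic_at_continuity f x0 : analytic_at f (RtoC x0) ->
  continuity_pt (fun x => Re (f (RtoC x))) x0.
Proof.
  intros H. destruct (analytic_at_real f x0 H) as (b & r & Hr & Hcv & E).
  apply (continuity_pt_ext_loc (fun x => PSeries b (x - x0))).
  - exists (mkposreal r Hr). intros x Hx. symmetry. apply E. exact Hx.
  - apply (continuity_pt_comp (fun x => x - x0) (PSeries b)).
    + apply (continuity_pt_minus (fun x => x) (fun _ => x0)).
      * apply derivable_continuous_pt, derivable_pt_id.
      * apply continuity_pt_const. intros ? ?; reflexivity.
    + apply PSeries_continuity, Hcv. rewrite Rminus_diag, Rabs_R0. exact Hr.
Qed.

(** The limit in [C_lim] is taken along the horizontal line through the point, so on the real
    axis the real part of the complex derivative is a real derivative. *)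
Lemma Re_C_derive f x0 l : is_derive (fun x => Re (f (RtoC x))) x0 l ->
  Re (C_derive f (RtoC x0)) = l.
Proof.
  intros H. apply is_derive_Reals in H.
  unfold C_derive, C_lim. simpl.
  match goal with |- real ?L = l => replace L with (Finite l); [reflexivity|symmetry] end.
  apply is_lim_unique.
  apply (is_lim_ext_loc (fun x => (Re (f (RtoC x)) - Re (f (RtoC x0))) / (x - x0))).
  - exists (mkposreal 1 Rlt_0_1). intros x _ Hx.
    change (x, 0) with (RtoC x).
    set (z := f (RtoC x)). set (z0 := f (RtoC x0)).
    assert (x - x0 <> 0) by lra.
    destruct z as [z1 z2]. destruct z0 as [z3 z4]. simpl. field. repeat split; try lra.
  - apply is_lim_spec. intros eps. destruct (H eps (cond_pos eps)) as [d Hd].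
    exists d. intros x Hx Hxx. simpl in Hx.
    specialize (Hd (x - x0) ltac:(lra) Hx).
    rewrite Rplus_minus in Hd. exact Hd.
Qed.

Lemma is_derive_pseries_loc F (b : nat -> R) r x : 0 < r ->
  (forall y, Rabs y < r -> Rbar_lt (Rabs y) (CV_radius b)) ->
  (forall y, Rabs y < r -> F y = PSeries b y) -> Rabs x < r ->
  is_derive F x (PSeries (PS_derive b) x).
Proof.
  intros Hr Hcv E Hx.
  apply (is_derive_ext_loc (PSeries b)).
  - assert (Hd : 0 < r - Rabs x) by lra.
    exists (mkposreal _ Hd). intros y Hy. symmetry. apply E.
    replace y with ((y - x) + x) by ring.
    eapply Rle_lt_trans; [apply Rabs_triang|].
    change (Rabs (y - x) < r - Rabs x) in Hy. lra.
  - apply is_derive_PSeries, Hcv, Hx.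
Qed.

Lemma tay2_PSeries (b : nat -> R) r : 0 < r ->
  (forall y, Rabs y < r -> Rbar_lt (Rabs y) (CV_radius b)) ->
  tay2 (PSeries b) (b 0%nat) (b 1%nat) (b 2%nat).
Proof.
  intros Hr Hcv.
  set (R3 := PSeries (PS_decr_n b 3)).
  assert (HC : continuity_pt R3 0).
  { apply PSeries_continuity. apply (CV_radius_ge _ r); [|rewrite Rabs_R0; exact Hr].
    intros x Hx. apply ex_pseries_decr_n; [|apply CV_radius_inside, Hcv, Hx].
    destruct (Req_dec x 0) as [E|E]; [left; exact E|right].
    exists (/ x). apply Rinv_l, E. }
  destruct (HC 1 Rlt_0_1) as (d & Hd & Hnear). simpl in Hnear. unfold Rdist in Hnear.
  exists (Rabs (R3 0) + 1), (Rmin r d). split; [apply Rmin_pos; lra|].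
  intros u Hu. pose proof (Rmin_l r d). pose proof (Rmin_r r d).
  rewrite (PSeries_decr_n b 2 u) by (apply CV_radius_inside, Hcv; lra).
  fold R3. simpl sum_f_R0.
  replace (b 0%nat * 1 + b 1%nat * (u * 1) + b 2%nat * (u * (u * 1)) + u ^ 3 * R3 u
           - (b 0%nat + b 1%nat * u + b 2%nat * u ^ 2)) with (R3 u * u ^ 3) by ring.
  rewrite Rabs_mult, <- RPow_abs. apply Rmult_le_compat_r; [apply pow_le, Rabs_pos|].
  assert (Rabs (R3 u - R3 0) < 1 \/ u = 0) as [Hc|Hc].
  { destruct (Req_dec u 0) as [E|E]; [right; exact E|left].
    apply Hnear. split; [split; [exact I|auto]|]. rewrite Rminus_0_r. lra. }
  - replace (R3 u) with ((R3 u - R3 0) + R3 0) by ring.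
    eapply Rle_trans; [apply Rabs_triang|]. lra.
  - rewrite Hc. lra.
Qed.

(** Near 0 the real part of [f] on the axis is a real power series, and [Re_C_derive] reduces
    both complex derivatives to derivatives of that series. *)
Lemma analytic_real_taylor f : analytic_at f (RtoC 0) ->
  exists b0 b1 b2, tay2 (fun x => Re (f (RtoC x))) b0 b1 b2 /\
    is_derive (fun x => Re (f (RtoC x))) 0 b1 /\
    Re (C_derive_n f 0 (RtoC 0)) = b0 /\ Re (C_derive_n f 1 (RtoC 0)) = b1 /\
    Re (C_derive_n f 2 (RtoC 0)) = 2 * b2.
Proof.
  intros H. destruct (analytic_at_real f 0 H) as (b & r & Hr & Hcv & E).
  assert (E' : forall x, Rabs x < r -> Re (f (RtoC x)) = PSeries b x).
  { intros x Hx. rewrite E by (rewrite Rminus_0_r; exact Hx). f_equal. ring. }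
  assert (H0 : Rabs 0 < r) by (rewrite Rabs_R0; exact Hr).
  assert (D1 : forall x, Rabs x < r ->
    is_derive (fun x => Re (f (RtoC x))) x (PSeries (PS_derive b) x))
    by (intros x Hx; apply (is_derive_pseries_loc _ b r); assumption).
  assert (D2 : is_derive (fun x => Re (C_derive f (RtoC x))) 0
                 (PSeries (PS_derive (PS_derive b)) 0)).
  { apply (is_derive_pseries_loc _ (PS_derive b) r); try assumption.
    - intros y Hy. rewrite CV_radius_derive. apply Hcv, Hy.
    - intros y Hy. apply Re_C_derive, D1, Hy. }
  exists (b 0%nat), (b 1%nat), (b 2%nat).
  assert (P1 : PSeries (PS_derive b) 0 = b 1%nat).
  { rewrite PSeries_0. unfold PS_derive. simpl. ring. }
  assert (P2 : PSeries (PS_derive (PS_derive b)) 0 = 2 * b 2%nat).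
  { rewrite PSeries_0. unfold PS_derive. simpl. ring. }
  split.
  { apply (tay2_ext (PSeries b) _ _ _ _ r Hr); [|apply (tay2_PSeries b r Hr Hcv)].
    intros u Hu. symmetry. apply E', Hu. }
  split; [rewrite <- P1; apply D1, H0|].
  split; [simpl; rewrite E', PSeries_0 by exact H0; reflexivity|].
  split.
  - rewrite <- P1. apply (Re_C_derive f), D1, H0.
  - rewrite <- P2. apply (Re_C_derive (C_derive f)), D2.
Qed.

(** * Recovering g_1 and g_2 from the Taylor coefficients *)

Lemma tay2_coef f c0 c1 c2 d0 d1 d2 : tay2 f c0 c1 c2 ->
  c0 = d0 -> c1 = d1 -> c2 = d2 -> tay2 f d0 d1 d2.
Proof. intros H -> -> ->. exact H. Qed.

(** The gap between the two bounds is cubic in [w], which is why the first two coefficients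
    are determined by an expansion of order 2. *)
Lemma gfrac_env_gap g1 g2 w : 0 <= g1 <= 1 -> 0 <= g2 <= 1 -> Rabs w <= 1 / 2 ->
  0 <= gfrac_env g1 g2 w 1 <= 3 /\
  Rabs (gfrac_env g1 g2 w (1 + (1 - g2) * w) - gfrac_env g1 g2 w 1) <= 8 * Rabs w ^ 3.
Proof.
  intros H1 H2 Hw. pose proof Hw as Hw'. apply Rabs_le_between in Hw'.
  assert (Hmul : forall c, 0 <= c <= 1 -> -1 / 2 <= c * w <= 1 / 2).
  { intros c Hc. apply Rabs_le_between in Hw. split; nra. }
  assert (Ha : 0 <= (1 - g1) * g2 <= 1) by nra.
  assert (Hb : 0 <= g1 + (1 - g1) * g2 <= 1) by nra.
  assert (Hd : 0 <= g1 * (1 - g2) <= 1) by nra.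
  pose proof (Hmul _ Ha) as Ma. pose proof (Hmul _ Hb) as Mb. pose proof (Hmul _ Hd) as Md.
  set (D1 := 1 + (g1 + (1 - g1) * g2) * w).
  set (D2 := (1 + w) * (1 + g1 * (1 - g2) * w)).
  assert (HD1 : 1 / 2 <= D1) by (unfold D1; lra).
  assert (HD2 : 1 / 4 <= D2) by (unfold D2; nra).
  assert (E1 : gfrac_env g1 g2 w 1 = (1 + (1 - g1) * g2 * w) / D1).
  { unfold gfrac_env, D1. f_equal. ring. }
  split.
  - rewrite E1. split.
    + apply Rmult_le_pos; [lra|]. apply Rlt_le, Rinv_0_lt_compat. lra.
    + apply (Rmult_le_reg_r D1); [lra|]. unfold Rdiv. rewrite Rmult_assoc, Rinv_l by lra. lra.
  - replace (gfrac_env g1 g2 w (1 + (1 - g2) * w) - gfrac_env g1 g2 w 1)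
      with (- ((1 - g1) * g2 * (g1 * (1 - g2))) * w ^ 3 * / (D1 * D2)).
    2:{ rewrite E1. unfold gfrac_env.
        replace ((1 + (1 - g2) * w) * (1 + g1 * w) + (1 - g1) * g2 * w) with D2
          by (unfold D2; ring).
        assert (D1 <> 0) by lra. assert (D2 <> 0) by lra.
        transitivity (((1 + (1 - g2) * w + (1 - g1) * g2 * w) * D1
                       - (1 + (1 - g1) * g2 * w) * D2) * / (D1 * D2)).
        - f_equal. unfold D1, D2. ring.
        - field. auto. }
    rewrite !Rabs_mult, Rabs_Ropp, <- RPow_abs.
    assert (0 < D1 * D2) by nra.
    rewrite (Rabs_pos_eq (/ (D1 * D2))) by (apply Rlt_le, Rinv_0_lt_compat; lra).
    assert (Hinv : / (D1 * D2) <= 8).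
    { replace 8 with (/ (1 / 8)) by field. apply Rinv_le_contravar; [lra|nra]. }
    assert (0 < / (D1 * D2)) by (apply Rinv_0_lt_compat; lra).
    assert (0 <= (1 - g1) * g2 * (g1 * (1 - g2)) <= 1) by nra.
    rewrite (Rabs_pos_eq ((1 - g1) * g2 * (g1 * (1 - g2)))) by lra.
    assert (0 <= Rabs w ^ 3) by (apply pow_le, Rabs_pos).
    assert ((1 - g1) * g2 * (g1 * (1 - g2)) * Rabs w ^ 3 <= Rabs w ^ 3) by nra.
    assert (0 <= (1 - g1) * g2 * (g1 * (1 - g2)) * Rabs w ^ 3) by nra.
    nra.
Qed.

(** The three equations compare the expansions of [(1 + phi)^2 (1 - s)] and
    [mu^2 (1 + s) (1 - phi)^2 v^2], where [v] is the fraction and [P], [N] are the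
    values at 0 of [1 + phi], [1 - phi].  The first one eliminates [mu]; the others are
    then linear in [p1] and in [p2]. *)
Lemma coefficient_equations mu g1 g2 p0 p1 p2 :
  let P := 1 + p0 in let N := 1 - p0 in
  let e2 := 2 * g1 * (2 * ((1 - g1) * g2) + 2 * g1 - 1) in
  0 < g1 < 1 -> 0 < P -> 0 < N ->
  P ^ 2 = mu ^ 2 * N ^ 2 ->
  2 * P * p1 - P ^ 2 = mu ^ 2 * (N ^ 2 - 2 * N * p1 - 4 * g1 * N ^ 2) ->
  2 * P * p2 + p1 ^ 2 - 2 * P * p1 =
    mu ^ 2 * (p1 ^ 2 - 2 * N * p2 - 2 * N * p1 - 4 * g1 * (N ^ 2 - 2 * N * p1)
              + N ^ 2 * (4 * g1 ^ 2 + 2 * e2)) ->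
  g1 = g1_of p0 p1 /\ g2 = g2_of p0 p1 (2 * p2).
Proof.
  intros P N e2 H1 HP HN E0 E1 E2.
  assert (E1' : N ^ 2 * (2 * P * p1 - P ^ 2) = P ^ 2 * (N ^ 2 - 2 * N * p1 - 4 * g1 * N ^ 2))
    by (rewrite E1, E0; ring).
  match type of E2 with ?l = mu ^ 2 * ?r => set (L := l) in *; set (R2 := r) in * end.
  assert (E2' : N ^ 2 * L = P ^ 2 * R2) by (rewrite E2, E0; ring).
  assert (HPN : P * N <> 0) by nra.
  assert (Ep1 : p1 = P * N * (1 - 2 * g1) / 2).
  { apply (Rmult_eq_reg_l (4 * (P * N))); [|nra].
    apply Rminus_diag_uniq.
    transitivity (N ^ 2 * (2 * P * p1 - P ^ 2) - P ^ 2 * (N ^ 2 - 2 * N * p1 - 4 * g1 * N ^ 2));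
      [unfold P, N; field|rewrite E1'; ring]. }
  assert (Ep2 : p2 = P * N / 2 * (4 * g1 * ((1 - g1) * g2) - 1 / 2 + (1 - 2 * g1) ^ 2 * N / 2)).
  { apply (Rmult_eq_reg_l (4 * (P * N))); [|nra].
    apply Rminus_diag_uniq.
    transitivity (N ^ 2 * L - P ^ 2 * R2);
      [unfold L, R2, e2; rewrite Ep1; unfold P, N; field|rewrite E2'; ring]. }
  split.
  - unfold g1_of. rewrite Ep1. replace (1 - p0 ^ 2) with (P * N) by (unfold P, N; ring).
    field. split; apply Rgt_not_eq; assumption.
  - unfold g2_of.
    replace ((2 * p1 - p0 ^ 2 + 1) * (2 * p1 + p0 ^ 2 - 1))
      with (- 4 * g1 * (1 - g1) * (P * N) ^ 2)
      by (rewrite Ep1; unfold P, N; field).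
    replace ((4 * p1 ^ 2 - 2 * (2 * p2) - p0 + p0 ^ 2 + p0 ^ 3 - 2 * (2 * p2) * p0 - 1) * (1 - p0))
      with (2 * g2 * (- 4 * g1 * (1 - g1) * (P * N) ^ 2))
      by (rewrite Ep2, Ep1; unfold P, N; field).
    field. unfold P, N in *. repeat split; nra.
Qed.

(** Solving the representation for the fraction gives
    [v^2 = (1 + phi)^2 (1 - s) / (mu^2 (1 + s) (1 - phi)^2)]; squaring removes the square
    root, and clearing the denominator leaves products of known expansions.  Replacing
    [v] by the bound with tail 1 costs only [O(u^3)]. *)
Lemma gfrac_coefficients (phi s : R -> R) p0 p1 p2 mu g1 g2 d :
  tay2 phi p0 p1 p2 -> tay2 s 0 1 0 -> 0 < mu -> 0 < g1 < 1 -> 0 <= g2 <= 1 ->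
  -1 < p0 < 1 -> 0 < d ->
  (forall u, Rabs u < d -> let w := 2 * s u / (1 - s u) in -1 < w ->
     exists v, phi u = 1 - 2 / (mu * (sqrt (1 + w) * v) + 1) /\
     (0 <= w -> gfrac_env g1 g2 w (1 + (1 - g2) * w) <= v <= gfrac_env g1 g2 w 1) /\
     (w <= 0 -> gfrac_env g1 g2 w 1 <= v <= gfrac_env g1 g2 w (1 + (1 - g2) * w))) ->
  g1 = g1_of p0 p1 /\ g2 = g2_of p0 p1 (2 * p2).
Proof.
  intros Hphi Hs Hmu H1 H2 Hp0 Hd Hrep.
  set (a := (1 - g1) * g2).
  (* [gfrac_env g1 g2 w 1] with [w = 2 s / (1 - s)], after multiplying through by [1 - s]. *)
  set (E := fun u => (1 * 1 + (2 * a - 1) * s u) * / (1 * 1 + (2 * (a + g1) - 1) * s u)).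
  assert (TE : tay2 E 1 (- 2 * g1) (2 * g1 * (2 * a + 2 * g1 - 1))).
  { eapply tay2_coef.
    - apply tay2_mult.
      + apply (tay2_lin (fun _ => 1) s 1 (2 * a - 1) _ _ _ _ _ _ (tay2_const 1) Hs).
      + apply tay2_inv.
        * apply (tay2_lin (fun _ => 1) s 1 (2 * (a + g1) - 1) _ _ _ _ _ _ (tay2_const 1) Hs).
        * lra.
    - field.
    - field.
    - field. }
  assert (TP : tay2 (fun u => 1 * 1 + 1 * phi u) (1 + p0) p1 p2).
  { eapply tay2_coef; [apply (tay2_lin (fun _ => 1) phi 1 1 _ _ _ _ _ _ (tay2_const 1) Hphi)|ring..]. }
  assert (TN : tay2 (fun u => 1 * 1 + -1 * phi u) (1 - p0) (- p1) (- p2)).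
  { eapply tay2_coef; [apply (tay2_lin (fun _ => 1) phi 1 (-1) _ _ _ _ _ _ (tay2_const 1) Hphi)|ring..]. }
  assert (TSm : tay2 (fun u => 1 * 1 + -1 * s u) 1 (-1) 0).
  { eapply tay2_coef; [apply (tay2_lin (fun _ => 1) s 1 (-1) _ _ _ _ _ _ (tay2_const 1) Hs)|ring..]. }
  assert (TSp : tay2 (fun u => mu ^ 2 * 1 + mu ^ 2 * s u) (mu ^ 2) (mu ^ 2) 0).
  { eapply tay2_coef; [apply (tay2_lin (fun _ => 1) s (mu ^ 2) (mu ^ 2) _ _ _ _ _ _ (tay2_const 1) Hs)|ring..]. }
  pose proof (tay2_mult _ _ _ _ _ _ _ _ (tay2_mult _ _ _ _ _ _ _ _ TP TP) TSm) as TA.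
  pose proof (tay2_mult _ _ _ _ _ _ _ _
    (tay2_mult _ _ _ _ _ _ _ _ (tay2_mult _ _ _ _ _ _ _ _ TN TN) TSp)
    (tay2_mult _ _ _ _ _ _ _ _ TE TE)) as TC.
  destruct (tay2_norm _ _ _ _ Hs) as (K & ds & Hds & HK & HsK).
  set (d' := Rmin (Rmin d ds) (Rmin (1 / 16) (/ (K + 1)))).
  assert (HK1 : 0 < / (K + 1)) by (apply Rinv_0_lt_compat; lra).
  assert (Hd' : 0 < d') by (repeat apply Rmin_pos; lra).
  assert (Hdd : d' <= d /\ d' <= ds /\ d' <= 1 / 16 /\ d' <= / (K + 1)).
  { unfold d'.
    pose proof (Rmin_l (Rmin d ds) (Rmin (1 / 16) (/ (K + 1)))).
    pose proof (Rmin_r (Rmin d ds) (Rmin (1 / 16) (/ (K + 1)))).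
    pose proof (Rmin_l d ds). pose proof (Rmin_r d ds).
    pose proof (Rmin_l (1 / 16) (/ (K + 1))). pose proof (Rmin_r (1 / 16) (/ (K + 1))).
    repeat split; lra. }
  match type of TA with tay2 ?f _ _ _ => set (fA := f) in TA end.
  match type of TC with tay2 ?f _ _ _ => set (fC := f) in TC end.
  (* The constants: [1 + s <= 2], [(1 - phi)^2 <= 4], [|v - e| <= 8 |w|^3],
     [v + e <= 7] and [|w| <= 4 |s| <= 8 |u|]. *)
  assert (Hclose : forall u, Rabs u < d' ->
    Rabs (fA u - fC u) <= mu ^ 2 * 2 * 4 * (8 * 4 ^ 3 * 7 * 8) * Rabs u ^ 3).
  { unfold fA, fC. clear TA TC fA fC.
  intros u Hu.
  specialize (Hrep u ltac:(lra)). specialize (HsK u ltac:(lra)).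
  replace (0 + 1 * u + 0 * u ^ 2) with u in HsK by ring.
  pose proof (Rabs_pos u) as Hu0.
  assert (Hs2 : Rabs (s u) <= 2 * Rabs u).
  { replace (s u) with ((s u - u) + u) by ring.
    eapply Rle_trans; [apply Rabs_triang|].
    assert (K * Rabs u ^ 2 <= 1).
    { assert (HKu : (K + 1) * Rabs u <= 1).
      { apply Rle_trans with ((K + 1) * / (K + 1)); [|apply Req_le; field; lra].
        apply Rmult_le_compat_l; lra. }
      assert (Rabs u ^ 2 <= Rabs u) by (simpl; nra). nra. }
    assert (K * Rabs u ^ 3 <= Rabs u).
    { replace (K * Rabs u ^ 3) with (K * Rabs u ^ 2 * Rabs u) by ring. nra. }
    lra. }
  set (su := s u) in *.
  assert (Hsu : Rabs su <= 1 / 8) by lra.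
  pose proof Hsu as Hsu'. apply Rabs_le_between in Hsu'.
  set (w := 2 * su / (1 - su)) in *.
  assert (Ew1 : 1 + w = (1 + su) / (1 - su)) by (unfold w; field; lra).
  assert (Hw4 : Rabs w <= 4 * Rabs su).
  { unfold w, Rdiv. rewrite !Rabs_mult, (Rabs_pos_eq 2), Rabs_inv, (Rabs_pos_eq (1 - su)) by lra.
    assert (Hi : / (1 - su) <= 2) by (replace 2 with (/ (1 / 2)) by field; apply Rinv_le_contravar; lra).
    pose proof (Rabs_pos su). nra. }
  assert (Hw2 : Rabs w <= 1 / 2) by lra.
  pose proof Hw2 as Hw2'. apply Rabs_le_between in Hw2'.
  destruct (Hrep ltac:(lra)) as (v & Hv & Hb1 & Hb2).
  destruct (gfrac_env_gap g1 g2 w ltac:(lra) H2 Hw2) as (HE & Hgap).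
  assert (EE : E u = gfrac_env g1 g2 w 1).
  { destruct (gfrac_env_denominators g1 g2 w 1) as (_ & _ & HD); try lra; [apply Rmin_l|].
    unfold E, gfrac_env. fold a. fold a in HD. fold su.
    assert (HD' : 0 < 1 + (2 * (a + g1) - 1) * su).
    { replace (1 + (2 * (a + g1) - 1) * su) with ((1 - su) * (1 * (1 + g1 * w) + a * w))
        by (unfold w; field; lra).
      apply Rmult_lt_0_compat; lra. }
    unfold w. field. repeat split; lra. }
  set (e := gfrac_env g1 g2 w 1) in *.
  assert (Hve : Rabs (v - e) <= 8 * Rabs w ^ 3).
  { eapply Rle_trans; [|exact Hgap].
    destruct (Rle_dec 0 w) as [Hw0|Hw0].
    - specialize (Hb1 Hw0). rewrite !Rabs_left1 by lra. lra.
    - specialize (Hb2 ltac:(lra)). rewrite !Rabs_pos_eq by lra. lra. }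
  assert (Hw3 : Rabs w ^ 3 <= 4 ^ 3 * 8 * Rabs u ^ 3).
  { replace (4 ^ 3 * 8 * Rabs u ^ 3) with ((4 * (2 * Rabs u)) ^ 3) by ring.
    apply pow_incr. split; [apply Rabs_pos|lra]. }
  assert (Hw38 : Rabs w ^ 3 <= 1 / 8).
  { replace (1 / 8) with ((1 / 2) ^ 3) by field. apply pow_incr. split; [apply Rabs_pos|lra]. }
  assert (Hv0 : 0 <= v).
  { destruct (Rle_dec 0 w) as [Hw0|Hw0]; [|specialize (Hb2 ltac:(lra)); lra].
    specialize (Hb1 Hw0).
    destruct (gfrac_env_denominators g1 g2 w (1 + (1 - g2) * w)) as (_ & D1 & D2); try lra;
      [apply Rmin_r|].
    eapply Rle_trans; [|apply Hb1]. unfold gfrac_env.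
    apply Rlt_le, Rdiv_lt_0_compat; assumption. }
  assert (Hv4 : v <= 4) by (apply Rabs_le_between in Hve; lra).
  set (X := mu * (sqrt (1 + w) * v)) in *.
  assert (HX : 0 <= X).
  { unfold X. pose proof (sqrt_pos (1 + w)). apply Rmult_le_pos; [lra|]. apply Rmult_le_pos; lra. }
  assert (HX2 : X ^ 2 = mu ^ 2 * (1 + w) * v ^ 2).
  { unfold X. pose proof (sqrt_sqrt (1 + w) ltac:(lra)) as Hsq.
    transitivity (mu ^ 2 * (sqrt (1 + w) * sqrt (1 + w)) * v ^ 2); [ring|rewrite Hsq; ring]. }
  assert (HN : 0 <= 1 * 1 + -1 * phi u <= 2).
  { rewrite Hv. replace (1 * 1 + -1 * (1 - 2 / (X + 1))) with (2 / (X + 1)) by ring.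
    split; [apply Rlt_le, Rdiv_lt_0_compat; lra|].
    apply (Rmult_le_reg_r (X + 1)); [lra|].
    unfold Rdiv. rewrite Rmult_assoc, Rinv_l by lra. lra. }
  assert (HPX : 1 * 1 + 1 * phi u = X * (1 * 1 + -1 * phi u)) by (rewrite Hv; field; lra).
  rewrite EE. set (n := 1 * 1 + -1 * phi u) in *. rewrite HPX.
  replace (X * n * (X * n) * (1 * 1 + -1 * su) - n * n * (mu ^ 2 * 1 + mu ^ 2 * su) * (e * e))
    with (mu ^ 2 * (1 + su) * n ^ 2 * ((v - e) * (v + e))).
  2:{ transitivity (X ^ 2 * n ^ 2 * (1 - su) - mu ^ 2 * (1 + su) * n ^ 2 * e ^ 2); [|ring].
      rewrite HX2, Ew1. field. lra. }
  assert (Hmu2 : 0 < mu ^ 2) by (apply pow_lt; lra).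
  assert (Hn2 : 0 <= n ^ 2 <= 4) by (split; simpl; nra).
  rewrite !Rabs_mult, (Rabs_pos_eq (mu ^ 2)), (Rabs_pos_eq (1 + su)), (Rabs_pos_eq (n ^ 2)),
    (Rabs_pos_eq (v + e)), (Rmult_assoc (mu ^ 2 * 2 * 4)) by lra.
  apply Rmult_le_compat.
  - apply Rmult_le_pos; [apply Rmult_le_pos|]; lra.
  - apply Rmult_le_pos; [apply Rabs_pos|lra].
  - apply Rmult_le_compat; try lra.
    + apply Rmult_le_pos; lra.
    + apply Rmult_le_compat_l; lra.
  - apply Rle_trans with (8 * Rabs w ^ 3 * 7); [|lra].
    apply Rmult_le_compat; try lra. apply Rabs_pos. }
  destruct (tay2_unique _ _ _ _ _ _ _ TA (tay2_squeeze fA fC _ _ _ _ d' TC Hd' Hclose))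
    as (E0 & E1 & E2).
  apply (coefficient_equations mu); try lra.
  etransitivity; [|etransitivity; [exact E2|]]; unfold a; ring.
Qed.

Lemma tay2_rescale f a k c0 c1 c2 : 0 < k -> tay2 f c0 c1 c2 ->
  tay2 (fun u => a * f (k * u)) (a * c0) (a * k * c1) (a * k ^ 2 * c2).
Proof.
  intros Hk (K & d & Hd & H). exists (Rabs a * K * k ^ 3), (d / k).
  split; [apply Rdiv_lt_0_compat; assumption|]. intros u Hu.
  assert (Hku : Rabs (k * u) < d).
  { rewrite Rabs_mult, (Rabs_pos_eq k) by lra.
    apply (Rmult_lt_compat_l k) in Hu; [|exact Hk].
    replace (k * (d / k)) with d in Hu by (field; lra). exact Hu. }
  specialize (H _ Hku).
  replace (a * f (k * u) - (a * c0 + a * k * c1 * u + a * k ^ 2 * c2 * u ^ 2))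
    with (a * (f (k * u) - (c0 + c1 * (k * u) + c2 * (k * u) ^ 2))) by ring.
  rewrite Rabs_mult. rewrite (Rabs_mult k), (Rabs_pos_eq k) in H by lra.
  replace (Rabs a * K * k ^ 3 * Rabs u ^ 3) with (Rabs a * (K * (k * Rabs u) ^ 3)) by ring.
  apply Rmult_le_compat_l; [apply Rabs_pos|exact H].
Qed.

(** * Conclusion *)

Lemma ellK_pos q : 0 < q < 1 -> 0 < ellK q.
Proof.
  intros Hq. destruct (jacobi_theta_constants q Hq) as (H3 & _).
  unfold ellK. pose proof PI_RGT_0. apply Rmult_lt_0_compat; [lra|]. apply pow_lt, H3.
Qed.

(** The second alternative is the value of the quotient at a zero of [rtheta4], where
    [sn], hence [Phi], is 0 by the convention on division by zero; it is as good as the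
    first, since [f x = f 0] wherever [Phi x = 0]. *)
Lemma rPhi_hits T B w : 0 < T -> 0 < B -> -1 < w -> w <> 0 ->
  exists x, -T < x < T /\ 0 < x * w /\ (rPhi T B x = w \/ rPhi T B x = 0).
Proof.
  intros HT HB Hw Hw0.
  pose proof (nome_bounds T B HT HB) as Hq. set (q := nome T B) in *.
  destruct (jacobi_theta_constants q Hq) as (H3 & _).
  pose proof (theta2_0_pos q Hq) as H2. pose proof PI_RGT_0 as HPI.
  (* The value of [sn] for which [2 sn / (1 - sn) = w]. *)
  set (c := w / (2 + w)).
  assert (Ec : c * (2 + w) = w) by (unfold c; field; lra).
  assert (Hc : -1 < c < 1).
  { split; apply (Rmult_lt_reg_r (2 + w)); lra. }
  assert (Hc0 : c <> 0) by (intros E; rewrite E in Ec; lra).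
  destruct (theta_ratio_surj q c Hq Hc Hc0) as (z & Hz & Hzc & E).
  exists (2 * T / PI * z).
  assert (HTP : 0 < 2 * T / PI) by (apply Rdiv_lt_0_compat; lra).
  assert (ET : 2 * T / PI * (PI / 2) = T) by (field; lra).
  split; [|split].
  - split.
    + replace (- T) with (2 * T / PI * - (PI / 2)) by (field; lra).
      apply Rmult_lt_compat_l; lra.
    + rewrite <- ET at 2. apply Rmult_lt_compat_l; lra.
  - replace (2 * T / PI * z * w) with (2 * T / PI * (z * c * (2 + w)))
      by (rewrite (Rmult_assoc z c (2 + w)), Ec; ring).
    apply Rmult_lt_0_compat; [exact HTP|]. apply Rmult_lt_0_compat; lra.
  - unfold rPhi. fold q.
    assert (Es : rsn q (ellK q / T * (2 * T / PI * z)) =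
                 theta3_0 q / theta2_0 q * (rtheta1 q z / rtheta4 q z)).
    { unfold rsn. replace (ellK q / T * (2 * T / PI * z) / theta3_0 q ^ 2) with z
        by (unfold ellK; field; lra). reflexivity. }
    rewrite Es, E.
    destruct (Req_dec (rtheta4 q z) 0) as [H4|H4].
    + right. rewrite H4. unfold Rdiv. rewrite !Rmult_0_r, !Rmult_0_l, !Rmult_0_r, Rmult_0_l.
      reflexivity.
    + left.
      replace (theta3_0 q / theta2_0 q * (c * (theta2_0 q / theta3_0 q) * rtheta4 q z / rtheta4 q z))
        with c by (field; lra).
      unfold c. field. lra.
Qed.

Lemma mobius_monotone M mu y z : 0 < M -> 0 < mu -> 0 <= y -> y <= z ->
  M * (1 - 2 / (mu * y + 1)) <= M * (1 - 2 / (mu * z + 1)).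
Proof.
  intros HM Hmu Hy Hyz. apply Rmult_le_compat_l; [lra|].
  assert (mu * y <= mu * z) by (apply Rmult_le_compat_l; lra).
  assert (0 <= mu * y) by (apply Rmult_le_pos; lra).
  assert (/ (mu * z + 1) <= / (mu * y + 1)) by (apply Rinv_le_contravar; lra).
  unfold Rdiv. lra.
Qed.

Lemma representation_at_zero M T B mu g f x : 0 < T -> 0 < B ->
  gfrac_representation M T B mu g f -> -T < x < T -> rPhi T B x = 0 ->
  Re (f (RtoC x)) = M * (1 - 2 / (mu * 1 + 1)).
Proof.
  intros HT HB Hrep Hx H0.
  destruct (representation_real M T B mu g f x HT HB Hrep Hx ltac:(lra))
    as (v & _ & Hv & Hb & _).
  rewrite H0 in *. specialize (Hb ltac:(lra)). unfold gfrac_env in Hb.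
  rewrite !Rmult_0_r, !Rplus_0_r, !Rmult_1_r, Rdiv_diag in Hb by lra.
  rewrite Hv, Rplus_0_r, sqrt_1. do 5 f_equal. lra.
Qed.

Lemma rPhi_0 T B : rPhi T B 0 = 0.
Proof.
  unfold rPhi, rsn. rewrite Rmult_0_r. unfold Rdiv at 1 4.
  replace (0 / theta3_0 (nome T B) ^ 2) with 0 by (unfold Rdiv; ring).
  rewrite Rmult_0_l, rtheta1_0. unfold Rdiv. rewrite !Rmult_0_l, !Rmult_0_r, Rmult_0_l. reflexivity.
Qed.

Lemma representation_coefficients M T B mu g f b0 b1 b2 :
  let k := T / ellK (nome T B) in
  0 < M -> 0 < T -> 0 < B ->
  gfrac_representation M T B mu g f ->
  g 1%nat <> 0 /\ g 1%nat <> 1 -> - M < b0 < M ->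
  tay2 (fun x => Re (f (RtoC x))) b0 b1 b2 ->
  g 1%nat = g1_of (/ M * b0) (/ M * k * b1) /\
  g 2%nat = g2_of (/ M * b0) (/ M * k * b1) (2 * (/ M * k ^ 2 * b2)).
Proof.
  intros k HM HT HB Hrep Hg1 Hb0 Hf.
  pose proof (nome_bounds T B HT HB) as Hq.
  pose proof (ellK_pos _ Hq) as HK.
  assert (Hk : 0 < k) by (apply Rdiv_lt_0_compat; assumption).
  assert (HM' : 0 < / M) by (apply Rinv_0_lt_compat, HM).
  destruct (rsn_expansion _ Hq) as (Ks & ds & Hds & Hs).
  pose proof Hrep as (Hmu & Hg & _).
  pose proof (Hg 1%nat ltac:(lia)) as H1. pose proof (Hg 2%nat ltac:(lia)) as H2.
  apply (gfrac_coefficients (fun u => / M * Re (f (RtoC (k * u)))) (rsn (nome T B))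
           _ _ _ mu _ _ (T / k)).
  - apply (tay2_rescale (fun x => Re (f (RtoC x)))); assumption.
  - exists Ks, ds. split; [exact Hds|]. intros u Hu.
    replace (0 + 1 * u + 0 * u ^ 2) with u by ring. apply Hs, Hu.
  - exact Hmu.
  - lra.
  - exact H2.
  - assert (/ M * M = 1) by (apply Rinv_l; lra). split; nra.
  - apply Rdiv_lt_0_compat; assumption.
  - intros u Hu w Hw.
    assert (Hx : - T < k * u < T).
    { apply Rabs_def2 in Hu.
      assert (ET : k * (T / k) = T) by (field; lra). split.
      - rewrite <- ET, Ropp_mult_distr_r. apply Rmult_lt_compat_l; lra.
      - apply Rlt_le_trans with (k * (T / k)); [apply Rmult_lt_compat_l; lra|lra]. }
    assert (Ew : rPhi T B (k * u) = w).
    { unfold rPhi, w. replace (ellK (nome T B) / T * (k * u)) with u by (unfold k; field; lra).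
      reflexivity. }
    destruct (representation_real M T B mu g f (k * u) HT HB Hrep Hx ltac:(lra))
      as (v & _ & Hv & Hb).
    rewrite Ew in *. exists v. split; [|exact Hb].
    rewrite Hv. rewrite <- Rmult_assoc, Rinv_l by lra. ring.
Qed.

Lemma Re_return_lift M T B f tau : class_A M T B f -> 0 < T -> - T < tau < T ->
  Re (f (RtoC tau)) = Re (f (RtoC 0)) -> f (RtoC tau) = f (RtoC 0).
Proof.
  intros (_ & Hreal & _) HT Ht E.
  pose proof (Hreal tau Ht) as E1. pose proof (Hreal 0 ltac:(lra)) as E2.
  destruct (f (RtoC tau)) as [z1 z2], (f (RtoC 0)) as [z3 z4]. simpl in *. congruence.
Qed.

Theorem theorem2p2 (M T B : R) (f : C -> C)
  (hM : 0 < M) (hT : 0 < T) (hB : 0 < B)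
  (hf : class_A_index 2 M T B f)
  (hf' : C_derive f (RtoC 0) <> RtoC 0) :
  let phi0 := phi_coef M T B f 0 in
  let phi1 := phi_coef M T B f 1 in
  let phi2 := phi_coef M T B f 2 in
  let g1 := g1_of phi0 phi1 in
  let g2 := g2_of phi0 phi1 phi2 in
  (g1 < 1 / 2 /\ 0 <= g1 ^ 2 - 4 * (1 - g1) ^ 2 * (1 - g2) * g2) \/
  (1 / 2 < g1 /\ 0 <= (1 - g1) ^ 2 - 4 * g1 ^ 2 * g2 * (1 - g2)) ->
  exists tau : R, - T < tau < T /\ tau <> 0 /\ f (RtoC tau) = f (RtoC 0).
Proof.
  intros phi0 phi1 phi2 g1 g2 Hcond.
  destruct hf as (HA & mu & g & Hrep & Hnz).
  pose proof HA as (Han & Hreal & Hbound).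
  assert (H0T : - T < 0 < T) by lra.
  destruct (analytic_real_taylor f (Han _ (rect_RtoC T B 0 hB H0T)))
    as (b0 & b1 & b2 & Htay & Hder & E0 & E1 & E2).
  assert (Hb0 : - M < b0 < M).
  { pose proof (Hbound _ (rect_RtoC T B 0 hB H0T)) as Hm.
    pose proof (re_le_Cmod (f (RtoC 0))) as Hre. simpl in E0. rewrite E0 in Hre.
    assert (Hlt : Rabs b0 < M) by lra. apply Rabs_def2 in Hlt. lra. }
  set (k := T / ellK (nome T B)).
  assert (Hk : 0 < k).
  { apply Rdiv_lt_0_compat; [exact hT|]. apply ellK_pos, nome_bounds; assumption. }
  assert (HM' : 0 < / M) by (apply Rinv_0_lt_compat, hM).
  assert (P0 : phi0 = / M * b0) by (unfold phi0, phi_coef; rewrite E0; simpl; unfold Rdiv; ring).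
  assert (P1 : phi1 = / M * k * b1)
    by (unfold phi1, phi_coef; rewrite E1; fold k; simpl; unfold Rdiv; ring).
  assert (P2 : phi2 = 2 * (/ M * k ^ 2 * b2))
    by (unfold phi2, phi_coef; rewrite E2; fold k; simpl; unfold Rdiv; ring).
  destruct (representation_coefficients M T B mu g f b0 b1 b2 hM hT hB Hrep
              (Hnz 1%nat ltac:(lia)) Hb0 Htay) as (Eg1 & Eg2).
  fold k in Eg1, Eg2. rewrite <- P0, <- P1 in Eg1. rewrite <- P0, <- P1, <- P2 in Eg2.
  fold g1 in Eg1. fold g2 in Eg2.
  pose proof Hrep as (Hmu & Hg & _).
  pose proof (Hg 1%nat ltac:(lia)) as G1. pose proof (Hg 2%nat ltac:(lia)) as G2.
  pose proof (Hnz 1%nat ltac:(lia)) as N1. pose proof (Hnz 2%nat ltac:(lia)) as N2.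
  assert (Hphi0 : 0 < 1 - phi0 ^ 2).
  { assert (-1 < phi0 < 1).
    { rewrite P0. assert (/ M * M = 1) by (apply Rinv_l; lra). split; nra. }
    nra. }
  assert (Hslope : (1 - 2 * g1) * (1 - phi0 ^ 2) = 2 * (/ M * k) * b1).
  { unfold g1, g1_of. rewrite P1. field. repeat split; lra. }
  assert (HMk : 0 < / M * k) by (apply Rmult_lt_0_compat; assumption).
  rewrite <- Eg1, <- Eg2 in Hcond. rewrite <- Eg1 in Hslope. clear g1 g2 Eg1 Eg2.
  set (F := fun x => Re (f (RtoC x))) in *.
  assert (HF : forall y, - T < y < T -> continuity_pt F y).
  { intros y Hy. apply analytic_at_continuity, Han, rect_RtoC; assumption. }
  assert (F0 : F 0 = M * (1 - 2 / (mu * 1 + 1))).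
  { apply (representation_at_zero M T B mu g f 0 hT hB Hrep H0T), rPhi_0. }
  assert (Hlift : (exists tau, - T < tau < T /\ tau <> 0 /\ F tau = F 0) ->
    exists tau : R, - T < tau < T /\ tau <> 0 /\ f (RtoC tau) = f (RtoC 0)).
  { intros (tau & Ht & Ht0 & Et). exists tau. split; [exact Ht|]. split; [exact Ht0|].
    apply (Re_return_lift M T B f tau HA hT Ht Et). }
  apply Hlift. clear Hlift.
  assert (Hpoint : forall w, -1 < w -> w <> 0 ->
    (exists tau, - T < tau < T /\ tau <> 0 /\ F tau = F 0) \/
    exists x, - T < x < T /\ x <> 0 /\ 0 < x * w /\ rPhi T B x = w).
  { intros w Hw Hw0.
    destruct (rPhi_hits T B w hT hB Hw Hw0) as (x & Hx & Hxw & [E|E]).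
    - right. exists x. repeat split; try lra; try exact E.
      intros E'. rewrite E' in Hxw. lra.
    - left. exists x. split; [exact Hx|]. split.
      + intros E'. rewrite E' in Hxw. lra.
      + rewrite F0. apply (representation_at_zero M T B mu g f x hT hB Hrep Hx E). }
  assert (Hsign : forall x w, 0 < x * w -> (0 < x -> 0 < w) /\ (x < 0 -> w < 0)).
  { intros x w H. split; intros Hx; nra. }
  destruct Hcond as [[Hlt Hdisc]|[Hlt Hdisc]].
  - destruct (env_crossing_lt_half (g 1%nat) (g 2%nat)) as (w & Hw & Hw0 & C1 & C2); try lra.
    destruct (Hpoint w Hw Hw0) as [H|(x & Hx & Hx0 & Hxw & E)]; [exact H|].
    destruct (Hsign x w Hxw) as [S1 S2].
    destruct (representation_real M T B mu g f x hT hB Hrep Hx ltac:(lra))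
      as (v & Hv0 & Hv & V1 & V2). fold (F x) in Hv. rewrite E in *.
    pose proof (sqrt_pos (1 + w)) as Hsq.
    apply (return_incr F T x b1); try assumption.
    + nra.
    + intros Hxp. rewrite Hv, F0.
      apply mobius_monotone; try lra; [apply Rmult_le_pos; lra|].
      eapply Rle_trans; [|apply C1, S1, Hxp].
      apply Rmult_le_compat_l; [exact Hsq|]. apply V1. specialize (S1 Hxp). lra.
    + intros Hxn. rewrite Hv, F0.
      apply mobius_monotone; try lra.
      eapply Rle_trans; [apply C2, S2, Hxn|].
      apply Rmult_le_compat_l; [exact Hsq|]. apply V2. specialize (S2 Hxn). lra.
  - destruct (env_crossing_gt_half (g 1%nat) (g 2%nat)) as (w & Hw & Hw0 & C1 & C2); try lra.
    destruct (Hpoint w Hw Hw0) as [H|(x & Hx & Hx0 & Hxw & E)]; [exact H|].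
    destruct (Hsign x w Hxw) as [S1 S2].
    destruct (representation_real M T B mu g f x hT hB Hrep Hx ltac:(lra))
      as (v & Hv0 & Hv & V1 & V2). fold (F x) in Hv. rewrite E in *.
    pose proof (sqrt_pos (1 + w)) as Hsq.
    apply (return_decr F T x b1); try assumption.
    + nra.
    + intros Hxp. rewrite Hv, F0.
      apply mobius_monotone; try lra.
      eapply Rle_trans; [apply C1, S1, Hxp|].
      apply Rmult_le_compat_l; [exact Hsq|]. apply V1. specialize (S1 Hxp). lra.
    + intros Hxn. rewrite Hv, F0.
      apply mobius_monotone; try lra; [apply Rmult_le_pos; lra|].
      eapply Rle_trans; [|apply C2, S2, Hxn].
      apply Rmult_le_compat_l; [exact Hsq|]. apply V2. specialize (S2 Hxn). lra.
Qed.
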